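(* Let $H$ be a separable infinite-dimensional Hilbert space, and let $\mathcal{U}$ be the complete metric space of all unitary $C_0$-groups on $H$ with the metric $d$ given in the context. Then the set $\mathcal{S}_{\mathcal{U}}\subset\mathcal{U}$ of all weakly stable unitary groups is of first category in $\mathcal{U}$, and the set $\mathcal{W}_{\mathcal{U}}\subset\mathcal{U}$ of all almost weakly stable unitary groups is residual in $\mathcal{U}$.
   Context: Hilbert spaces are complex. A unitary $C_0$-group on $H$ is a strongly continuous one-parameter group $U(\cdot)=(U(t))_{t\in\mathbb{R}}$ of unitary operators on $H$. The metric on the set $\mathcal{U}$ of all unitary $C_0$-groups on $H$ is $$d(U(\cdot),V(\cdot)):=\sum_{n,j=1}^\infty \frac{\sup_{t\in[-n,n]}\|U(t)x_j-V(t)x_j\|}{2^{j+n}\|x_j\|},\qquad U(\cdot),V(\cdot)\in\mathcal{U},$$ where $\{x_j\}_{j=1}^\infty$ is a fixed dense subset of $H$ with all $x_j\neq 0$. $U(\cdot)$ is weakly stable if $\lim_{t\to\infty}\langle U(t)x,y\rangle=0$ for every $x,y\in H$. $U(\cdot)$ is almost weakly stable if there is a (measurable) set $M\subset[0,\infty)$ of asymptotic density one, i.e. $\lim_{t\to\infty}\frac{\lambda(M\cap[0,t])}{t}=1$ with $\lambda$ the Lebesgue measure, such that $\lim_{t\to\infty,\,t\in M}\langle U(t)x,y\rangle=0$ for every $x,y\in H$. A subset of a metric space is of first category if it is a countable union of nowhere dense sets; it is residual if its complement is of first category. *)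

(* Defs.v *)
From HB Require Import structures.
From mathcomp Require Import all_boot all_order all_algebra.
From mathcomp Require Import finmap complex ring lra.
From mathcomp Require Import all_classical all_reals all_analysis.

Set Implicit Arguments.
Unset Strict Implicit.
Unset Printing Implicit Defensive.

Import Order.TTheory GRing.Theory Num.Theory.
Import numFieldNormedType.Exports.

Local Open Scope classical_set_scope.
Local Open Scope ring_scope.
Local Open Scope complex_scope.

HB.mixin Record NormedModule_isHilbert (R : realType) H
    & CompleteNormedModule R[i] H := {
  inner : H -> H -> R[i];
  inner_linearl : forall w : H, linear_for *%R (inner ^~ w);
  inner_conj : forall u v : H, inner v u = (inner u v)^*;
  inner_norm : forall u : H, inner u u = `|u| ^+ 2
}.

#[short(type="hilbertType")]
HB.structure Definition Hilbert (R : realType) :=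
  {H of NormedModule_isHilbert R H & CompleteNormedModule R[i] H}.

Section InnerProduct.
Context {R : realType} {H : hilbertType R}.
Implicit Types u v w : H.

Let inner_linearr u : linear_for (Num.conj \; *%R) (inner u).
Proof.
move=> a v w.
by rewrite inner_conj inner_linearl rmorphD rmorphM/= -!inner_conj.
Qed.

HB.instance Definition _ := @bilinear_isBilinear.Build R[i] H H R[i]
  *%R (Num.conj \; *%R) (@inner R H) (inner_linearl, inner_linearr).

Let inner_hermitian u v : inner u v = (-1) ^+ false * Num.conj (inner v u).
Proof. by rewrite expr0 mul1r inner_conj. Qed.

HB.instance Definition _ := @isHermitianSesquilinear.Build R[i] H false
  Num.conj (@inner R H) inner_hermitian.

Let inner_pos u : u != 0 -> 0 < inner u u.
Proof. by move=> u0; rewrite inner_norm exprn_gt0// normr_gt0. Qed.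

HB.instance Definition _ := @isDotProduct.Build R[i] H (@inner R H) inner_pos.

End InnerProduct.

Section HilbertSpace.
Context {R : realType} {H : hilbertType R}.
Implicit Types (u v : H) (T : H -> H).

(* The norm of a module over R[i] takes its values in R[i]; [hnorm] is the
   same nonnegative number, seen in R (see [normE]). *)
Definition hnorm u : R := complex.Re `|u|.

Lemma normE u : `|u| = (hnorm u)%:C.
Proof. by rewrite RRe_real// ger0_real. Qed.

Lemma hnorm_ge0 u : 0 <= hnorm u.
Proof. by rewrite -lecR -normE normr_ge0. Qed.

Lemma hnorm0 : hnorm 0 = 0.
Proof. by rewrite /hnorm normr0. Qed.

Lemma hnorm_eq0 u : hnorm u = 0 -> u = 0.
Proof. by move=> u0; apply/eqP; rewrite -normr_eq0 normE u0. Qed.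

Lemma hnormD u v : hnorm (u + v) <= hnorm u + hnorm v.
Proof. by rewrite -lecR rmorphD/= -!normE ler_normD. Qed.

Lemma hdistC u v : hnorm (u - v) = hnorm (v - u).
Proof. by rewrite /hnorm distrC. Qed.

Lemma hdist_triangle v u w : hnorm (u - w) <= hnorm (u - v) + hnorm (v - w).
Proof. by rewrite (le_trans _ (hnormD _ _))// addrA subrK. Qed.

Lemma hcvgP {X} {F : set_system X} {FF : Filter F} (f : X -> H) u :
  f @ F --> u <->
  forall e : R, 0 < e -> \forall t \near F, hnorm (u - f t) < e.
Proof.
split=> [/cvgrPdist_lt fu e e0|fu].
  have /fu : 0 < e%:C by rewrite ltcR.
  by apply: filterS => t; rewrite normE ltcR.
apply/cvgrPdist_lt => e e0.
have eE : e = (complex.Re e)%:C by rewrite RRe_real// gtr0_real.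
have /fu : 0 < complex.Re e by rewrite -ltcR -eE.
by apply: filterS => t; rewrite eE normE ltcR.
Qed.

Lemma hlim_eq u v : (forall e : R, 0 < e -> hnorm (u - v) <= e) -> u = v.
Proof.
move=> uv; apply/eqP; rewrite -subr_eq0; apply/eqP/hnorm_eq0.
apply/eqP; rewrite eq_le hnorm_ge0 andbT.
by apply/ler_addgt0Pr => e e0; rewrite add0r uv.
Qed.

Lemma inner_hnorm u : inner u u = (hnorm u ^+ 2)%:C.
Proof. by rewrite inner_norm normE rmorphXn. Qed.

Lemma innerDZ (a : R[i]) u v : inner (u + a *: v) (u + a *: v) =
  inner u u + (a^* * inner u v + a * inner v u + a * a^* * inner v v).
Proof.
rewrite linearDl !linearDr linearZl_LR !linearZ/= linearZl_LR/=.
by rewrite !addrA mulrA (mulrC _ a).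
Qed.

Lemma polarization u v : inner u v *+ 4 =
  inner (u + 1 *: v) (u + 1 *: v) - inner (u + (- 1) *: v) (u + (- 1) *: v)
  + 'i * inner (u + 'i *: v) (u + 'i *: v)
  - 'i * inner (u + (- 'i) *: v) (u + (- 'i) *: v).
Proof.
rewrite !innerDZ !rmorphN/= !rmorph1 conjCi.
move: (inner u u) (inner u v) (inner v u) (inner v v) => A X Y B.
rewrite -[LHS]addr0 -[X in _ + X](mulr0 (2 * (Y - X))).
have <- : 'i * 'i + 1 = 0 :> R[i] by rewrite -expr2 sqrCi addNr.
by ring.
Qed.

Definition unitary T : Prop :=
  [/\ linear T, isometry inner inner T & forall v, exists u, T u = v].

End HilbertSpace.

Definition infinite_dimensional (R : realType) (H : hilbertType R) : Prop :=
  forall (n : nat) (e : 'I_n -> H), exists u : H,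
    forall a : 'I_n -> R[i], u <> \sum_(i < n) a i *: e i.

Record unitary_group (R : realType) (H : hilbertType R) := UnitaryGroup {
  ugroup :> R -> H -> H ;
  ugroup_unitary : forall t, unitary (ugroup t) ;
  ugroup0 : forall u, ugroup 0 u = u ;
  ugroupD : forall s t u, ugroup (s + t) u = ugroup s (ugroup t u) ;
  ugroup_continuous : forall u, continuous (ugroup ^~ u)
}.

Section UnitaryGroup.
Context {R : realType} {H : hilbertType R}.
Implicit Types U V W : unitary_group H.

Lemma ugroupB U t u v : U t (u - v) = U t u - U t v.
Proof.
have [linU _ _] := ugroup_unitary U t.
by rewrite addrC -scaleN1r linU scaleN1r addrC.
Qed.

Lemma hnorm_ugroup U t u : hnorm (U t u) = hnorm u.
Proof.
have [_ isoU _] := ugroup_unitary U t.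
have : inner (U t u) (U t u) = inner u u := isoU u u.
rewrite !inner_hnorm => /(congr1 (@complex.Re R))/= /eqP.
by rewrite eqrXn2 ?hnorm_ge0// => /eqP.
Qed.

Lemma ugroup_eqP U V : (forall t u, U t u = V t u) -> U = V.
Proof.
move=> UV; have {UV} : ugroup U = V by apply/funext => t; apply/funext.
case: U V => [U ? ? ? ?] [V ? ? ? ?] /= UV.
by subst V; f_equal; exact: Prop_irrelevance.
Qed.

Lemma isometry_hnorm (T : H -> H) : linear T ->
  (forall u, hnorm (T u) = hnorm u) -> isometry inner inner T.
Proof.
move=> linT nT u v.
have innerT (a : R[i]) : inner (T u + a *: T v) (T u + a *: T v) =
    inner (u + a *: v) (u + a *: v).
  by rewrite addrC -linT !inner_hnorm nT addrC.
have /eqP := polarization (T u) (T v).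
rewrite !innerT -polarization -subr_eq0 -mulrnBl mulrn_eq0/= subr_eq0.
by move=> /eqP.
Qed.

Definition trivial_group : unitary_group H.
Proof.
apply: (@UnitaryGroup _ _ (fun=> idfun)) => //.
  by move=> t; split => // v; exists v.
by move=> u; exact: cst_continuous.
Defined.

End UnitaryGroup.

Record dense_sequence (R : realType) (H : hilbertType R) := DenseSequence {
  dseq :> nat -> H ;
  dseq_dense : dense (range dseq) ;
  dseq_neq0 : forall j, dseq j <> 0
}.

(* The dense sequence is indexed from 0: [x j] is the x_(j+1) of the 1-based
   convention, and [p = (n, j)] stands for the pair of indices (n+1, j+1). *)
Definition ugap (R : realType) (H : hilbertType R) (U V : unitary_group H)
    (n : nat) (u : H) : R :=
  sup [set hnorm (U t u - V t u) | t in `[- n%:R, n%:R]].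

Definition udist_term (R : realType) (H : hilbertType R)
    (x : dense_sequence H) (U V : unitary_group H) (p : nat * nat) : R :=
  ugap U V p.1.+1 (x p.2) / (2 ^+ (p.2.+1 + p.1.+1) * hnorm (x p.2)).

Definition udist (R : realType) (H : hilbertType R)
    (x : dense_sequence H) (U V : unitary_group H) : R :=
  fine (\esum_(p in [set: nat * nat]) (udist_term x U V p)%:E).

(* An alias that depends on [x], since the distance does. *)
Definition ugroup_space (R : realType) (H : hilbertType R)
  (x : dense_sequence H) : Type := unitary_group H.

Section UnitaryGroupMetric.
Context {R : realType} {H : hilbertType R}.
Variable x : dense_sequence H.
Implicit Types (U V W : unitary_group H) (p : nat * nat).

Let gap_le U V t u : hnorm (U t u - V t u) <= 2 * hnorm u.
Proof.
rewrite (le_trans (hdist_triangle 0 _ _))// subr0 sub0r -(sub0r (V t u)) hdistC.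
by rewrite subr0 !hnorm_ugroup mulrDl mul1r.
Qed.

Lemma ugap_ub U V n t u : t \in `[- n%:R, n%:R] ->
  hnorm (U t u - V t u) <= ugap U V n u.
Proof.
move=> tn; apply: ub_le_sup; last by exists t.
by exists (2 * hnorm u) => _ [s _ <-].
Qed.

Lemma ugap_leP U V n u (e : R) :
  (forall t, t \in `[- n%:R, n%:R] -> hnorm (U t u - V t u) <= e) ->
  ugap U V n u <= e.
Proof.
move=> ue; apply: ge_sup; last by move=> _ [t tn <-]; exact: ue.
by exists (hnorm (U 0 u - V 0 u)); exists 0; rewrite //= in_itv/= oppr_le0 ler0n.
Qed.

Lemma ugap_ge0 U V n u : 0 <= ugap U V n u.
Proof.
rewrite (le_trans (hnorm_ge0 (U 0 u - V 0 u)))// ugap_ub// in_itv/=.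
by rewrite oppr_le0 ler0n.
Qed.

Lemma ugapC U V n u : ugap U V n u = ugap V U n u.
Proof.
by apply/eqP; rewrite eq_le; apply/andP; split; apply: ugap_leP => t tn;
  rewrite hdistC ugap_ub.
Qed.

Lemma ugap_triangle V U W n u : ugap U W n u <= ugap U V n u + ugap V W n u.
Proof.
apply: ugap_leP => t tn.
by rewrite (le_trans (hdist_triangle (V t u) _ _))// lerD ?ugap_ub.
Qed.

Lemma hdseq_gt0 j : 0 < hnorm (x j).
Proof.
rewrite lt_neqAle hnorm_ge0 andbT eq_sym; apply/eqP => /hnorm_eq0.
exact: dseq_neq0.
Qed.

Let w p : R := (2 ^+ (p.2.+1 + p.1.+1))^-1.

Let w_gt0 p : 0 < w p. Proof. by rewrite invr_gt0 exprn_gt0. Qed.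

Let esum_w : (\esum_(p in [set: nat * nat]) (w p)%:E <= 1)%E.
Proof.
have -> : [set: nat * nat] = setT `*`` (fun=> setT) by apply/seteqP; split.
rewrite -(esum_esum (a := fun n j => (w (n, j))%:E)); last first.
  by move=> n j _ _; rewrite lee_fin ltW.
apply: (@le_trans _ _ (\esum_(n in [set: nat]) (1 / (2 ^ n.+1)%:R)%:E)%E).
  apply: le_esum => n _.
  rewrite -nneseries_esumT; last by move=> j; rewrite lee_fin ltW.
  apply: (le_trans _ (@epsilon_trick0 R (1 / (2 ^ n.+1)%:R) xpredT _)) => //.
  apply: lee_nneseries => [j _ _|j _]; first by rewrite lee_fin ltW.
  by rewrite lee_fin /w/= exprD invfM mulrC !natrX mul1r.
rewrite -nneseries_esumT; last by move=> j; rewrite lee_fin.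
exact: epsilon_trick0.
Qed.

Let sum_w (X : set (nat * nat)) : finite_set X -> \sum_(p \in X) w p <= 1.
Proof.
move=> finX; rewrite -lee_fin (le_trans _ esum_w)//.
apply: ereal_sup_ubound; exists X; first by split.
by rewrite fsumEFin.
Qed.

Let termE U V p :
  udist_term x U V p = w p * (ugap U V p.1.+1 (x p.2) / hnorm (x p.2)).
Proof. by rewrite /udist_term invfM mulrCA mulrA. Qed.

Let term_ge0 U V p : 0 <= udist_term x U V p.
Proof.
by rewrite termE mulr_ge0 ?(ltW (w_gt0 _))// divr_ge0 ?ugap_ge0// hnorm_ge0.
Qed.

Let term_le U V p : udist_term x U V p <= w p * 2.
Proof.
rewrite termE ler_wpM2l ?(ltW (w_gt0 _))// ler_pdivrMr ?hdseq_gt0//.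
by apply: ugap_leP => t _; exact: gap_le.
Qed.

Let le_fsum (X : set (nat * nat)) (f g : nat * nat -> R) : finite_set X ->
  (forall p, X p -> f p <= g p) -> \sum_(p \in X) f p <= \sum_(p \in X) g p.
Proof.
move=> finX fg; rewrite -lee_fin -!fsumEFin//.
by apply: lee_fsum => // p Xp; rewrite lee_fin fg.
Qed.

Let udist_fin U V :
  (\esum_(p in [set: nat * nat]) (udist_term x U V p)%:E)%E \is a fin_num.
Proof.
rewrite ge0_fin_numE; last by apply: esum_ge0 => p _; rewrite lee_fin.
apply: (@le_lt_trans _ _ (2%:E)); last exact: ltry.
apply: ge_ereal_sup => _ [X [finX _] <-].
rewrite fsumEFin// lee_fin (@le_trans _ _ (\sum_(p \in X) (w p * 2)))//.
  by apply: le_fsum => // p _.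
by rewrite -mulr_fsuml ler_piMl// sum_w.
Qed.

Let udistE U V : (udist x U V)%:E =
  (\esum_(p in [set: nat * nat]) (udist_term x U V p)%:E)%E.
Proof. by rewrite fineK. Qed.

Lemma udist_leP U V (e : R) :
  (forall X, finite_set X -> \sum_(p \in X) udist_term x U V p <= e) ->
  udist x U V <= e.
Proof.
move=> Xe; rewrite -lee_fin udistE; apply: ge_ereal_sup => _ [X [finX _] <-].
by rewrite fsumEFin// lee_fin Xe.
Qed.

Lemma udist_fsum_ub U V X : finite_set X ->
  \sum_(p \in X) udist_term x U V p <= udist x U V.
Proof.
move=> finX; rewrite -lee_fin udistE; apply: ereal_sup_ubound.
by exists X; [split|rewrite fsumEFin].
Qed.

Lemma udist_term_ub U V p : udist_term x U V p <= udist x U V.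
Proof.
by have := @udist_fsum_ub U V [set p] (finite_set1 p); rewrite fsbig_set1.
Qed.

Lemma udistxx U : udist x U U = 0.
Proof.
rewrite /udist esum1// => p _; rewrite termE.
suff -> : ugap U U p.1.+1 (x p.2) = 0 by rewrite mul0r mulr0.
apply/eqP; rewrite eq_le ugap_ge0 andbT; apply: ugap_leP => t _.
by rewrite subrr hnorm0.
Qed.

Lemma udistC U V : udist x U V = udist x V U.
Proof.
by congr fine; apply: eq_esum => p _; rewrite /udist_term ugapC.
Qed.

Lemma udist_triangle V U W : udist x U W <= udist x U V + udist x V W.
Proof.
rewrite -lee_fin EFinD !udistE -esumD; last 2 first.
- by move=> p _; rewrite lee_fin.
- by move=> p _; rewrite lee_fin.
apply: le_esum => p _; rewrite -EFinD lee_fin !termE -mulrDr -mulrDl.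
rewrite ler_wpM2l ?(ltW (w_gt0 _))// ler_wpM2r ?invr_ge0 ?hnorm_ge0//.
exact: ugap_triangle.
Qed.

Lemma hdseq_near u (e : R) : 0 < e -> exists j, hnorm (u - x j) < e.
Proof.
move=> e0; have e0' : 0 < e%:C by rewrite ltcR.
have [||v [/interior_subset/= uj [j _ jE]]] :=
    @dseq_dense _ _ x (ball u e%:C)°.
- by exists u; exact: (nbhsx_ballx u _ e0').
- exact: open_interior.
exists j.
by rewrite -ltcR -normE jE; move: uj; rewrite -ball_normE.
Qed.

Lemma ugap_near (e : R) n u : 0 < e -> exists2 d : R, 0 < d &
  forall U V, udist x U V < d -> ugap U V n u <= e.
Proof.
move=> e0; have e40 : 0 < e / 4 by rewrite divr_gt0.
have [j uj] := hdseq_near u e40.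
pose p := (n, j); exists (w p * (e / 2 / hnorm (x j))).
  by rewrite mulr_gt0// divr_gt0 ?hdseq_gt0// divr_gt0.
move=> U V /(le_lt_trans (udist_term_ub U V p)).
rewrite termE ltr_pM2l// ltr_pM2r ?invr_gt0 ?hdseq_gt0//= => UV.
apply: ugap_leP => t tn.
rewrite (le_trans (hdist_triangle (U t (x j)) _ _))//.
rewrite (le_trans (lerD (lexx _) (hdist_triangle (V t (x j)) _ _)))//.
rewrite -!ugroupB !hnorm_ugroup [X in _ + (_ + X)]hdistC.
have tn1 : t \in `[- n.+1%:R, n.+1%:R].
  move: tn; rewrite !in_itv/= => /andP[nt tn].
  rewrite (le_trans _ nt) ?lerN2 ?ler_nat// (le_trans tn)// ler_nat//.
have := ugap_ub U V (x j) tn1; lra.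
Qed.

Let nat_itv (t : R) : exists n, t \in `[- n%:R, n%:R].
Proof.
exists (Num.trunc `|t|).+1; rewrite in_itv/= -ler_norml.
by rewrite ltW// truncnS_gt.
Qed.

Lemma udist_eq0 U V : udist x U V = 0 -> U = V.
Proof.
move=> UV; apply: ugroup_eqP => t u; apply: hlim_eq => e e0.
have [n tn] := nat_itv t.
have [d d0 /(_ U V)] := ugap_near n u e0.
by rewrite UV => /(_ d0); apply: le_trans; exact: ugap_ub.
Qed.

HB.instance Definition _ := gen_eqMixin (ugroup_space x).
HB.instance Definition _ := gen_choiceMixin (ugroup_space x).
HB.instance Definition _ := isPointed.Build (ugroup_space x) trivial_group.
HB.instance Definition _ := @isMetric.Build R (ugroup_space x)
  (udist x) udistxx udist_eq0 udistC udist_triangle.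

Lemma ugroup_nbhsP (U : ugroup_space x) (A : set (ugroup_space x)) :
  nbhs U A <-> exists2 e : R, 0 < e & forall V, udist x U V < e -> A V.
Proof.
exact: (@metricType_numDomainType.nbhs_mdistP R (ugroup_space x) U A).
Qed.

Section Completeness.
Variables (F : set_system (ugroup_space x)) (FF : ProperFilter F).
Hypothesis cF : cauchy F.

Let udist_cauchy (e : R) : 0 < e ->
  exists2 A, F A & forall U V, A U -> A V -> udist x U V < e.
Proof.
move=> e0; have /cauchy_ballP/(_ e e0)[[A B]/= [FA FB] AB] := cF.
exists (A `&` B); first exact: filterI.
by move=> U V [AU _] [_ BV]; have := AB (U, V); exact.
Qed.

Let gap_cauchy (e : R) n u : 0 < e ->
  exists2 A, F A & forall U V, A U -> A V -> ugap U V n u <= e.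
Proof.
move=> e0; have [d d0 dUV] := ugap_near n u e0.
have [A FA AUV] := udist_cauchy d0.
by exists A => // U V AU AV; apply: dUV; exact: AUV.
Qed.

Let L t u : H := lim ((fun V : ugroup_space x => V t u) @ F).

Let cvgL t u : (fun V : ugroup_space x => V t u) @ F --> L t u.
Proof.
apply: cauchy_cvg; apply: cauchy_exP => e e0.
have eE : e = (complex.Re e)%:C by rewrite RRe_real// gtr0_real.
have Re0 : 0 < complex.Re e by rewrite -ltcR -eE.
have [n tn] := nat_itv t.
have [A FA AUV] := gap_cauchy n u (divr_gt0 Re0 (ltr0n _ 2)).
have [U AU] := filter_ex FA.
exists (U t u).
change (F [set V : ugroup_space x | ball (U t u) e (V t u)]).
apply: filterS FA => V AV /=.
rewrite -ball_normE /= eE normE ltcR.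
apply: (le_lt_trans (ugap_ub U V u tn)).
apply: (le_lt_trans (AUV _ _ AU AV)).
by rewrite ltr_pdivrMr// ltr_pMr// ltr1n.
Qed.

Let L_unif (e : R) n u : 0 < e -> \forall V \near F,
  forall t, t \in `[- n%:R, n%:R] ->
    hnorm (L t u - (V : ugroup_space x) t u) <= e.
Proof.
move=> e0; have [A FA AUV] := gap_cauchy n u e0.
apply: (filterS _ FA) => V AV t tn; apply/ler_addgt0Pr => d d0.
have /hcvgP/(_ d d0) Ld := @cvgL t u.
have [U [AU /= LU]] := filter_ex (filterI FA Ld).
rewrite (le_trans (hdist_triangle (U t u) _ _))// addrC lerD// ?(ltW LU)//.
by rewrite (le_trans (ugap_ub _ _ _ tn))// AUV.
Qed.

Let L_near (e : R) t u : 0 < e ->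
  \forall V \near F, hnorm (L t u - (V : ugroup_space x) t u) <= e.
Proof.
move=> e0; have [n tn] := nat_itv t.
by have := L_unif n u e0; apply: filterS => V; exact.
Qed.

Let L_linear t : linear (L t).
Proof.
move=> a u v; apply: cvg_lim; first exact: norm_hausdorff.
have -> : (fun V : ugroup_space x => V t (a *: u + v)) =
    (fun V : ugroup_space x => a *: V t u + V t v).
  by apply/funext => V; have [linV _ _] := ugroup_unitary V t; exact: linV.
by apply: cvgD; [apply: cvgZr|]; exact: cvgL.
Qed.

Let hnormL t u : hnorm (L t u) = hnorm u.
Proof.
apply/eqP; rewrite eq_le; apply/andP; split; apply/ler_addgt0Pr => e e0;
  have [V LV] := filter_ex (L_near t u e0).
  have := hdist_triangle (V t u) (L t u) 0.
  rewrite !subr0 hnorm_ugroup; lra.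
have := hdist_triangle (L t u) (V t u) 0.
rewrite !subr0 hnorm_ugroup hdistC; lra.
Qed.

Let L_isometry t : isometry inner inner (L t).
Proof. exact: isometry_hnorm. Qed.

Let L0 u : L 0 u = u.
Proof.
apply: hlim_eq => e /(L_near 0 u)/filter_ex[V].
by rewrite ugroup0.
Qed.

Let LD s t u : L (s + t) u = L s (L t u).
Proof.
apply: hlim_eq => e e0; have e3 : 0 < e / 3 by rewrite divr_gt0.
have [V [[V1 V2] V3]] := filter_ex (filterI (filterI
  (L_near (s + t) u e3) (L_near t u e3)) (L_near s (L t u) e3)).
have := hdist_triangle (V s (V t u)) (L (s + t) u) (L s (L t u)).
have := hdist_triangle (V s (L t u)) (V s (V t u)) (L s (L t u)).
rewrite -ugroupB hnorm_ugroup; move: V1 V2 V3; rewrite ugroupD.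
rewrite (hdistC (L t u)) (hdistC (L s (L t u))); lra.
Qed.

Let L_continuous u : continuous (L ^~ u).
Proof.
move=> t; apply/hcvgP => e e0; have e4 : 0 < e / 4 by rewrite divr_gt0.
have [n tn] := nat_itv t.
have [V LV] := filter_ex (L_unif n.+1 u e4).
have /hcvgP/(_ _ e4) Vt := @ugroup_continuous _ _ V u t.
have tn1 : \forall s \near t, s \in `[- n.+1%:R, n.+1%:R].
  have /cvgrPdist_lt/(_ 1 ltr01) := @cvg_id _ (nbhs t).
  apply: filterS => s; move: tn; rewrite !in_itv/= -!ler_norml => tn ts.
  rewrite -natr1 -(subrK t s) (le_trans (ler_normD _ _))// addrC lerD//.
  by rewrite distrC ltW.
apply: filterS2 tn1 Vt => s sn Vs.
have tn' : t \in `[- n.+1%:R, n.+1%:R].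
  move: tn; rewrite !in_itv/= -!ler_norml => /le_trans; apply.
  by rewrite ler_nat.
have := hdist_triangle (V t u) (L t u) (L s u).
have := hdist_triangle (V s u) (V t u) (L s u).
rewrite [in X in _ <= _ + X -> _](hdistC (V s u)).
by have := LV _ sn; have := LV _ tn'; lra.
Qed.

Let L_unitary t : unitary (L t).
Proof.
by split => // v; exists (L (- t) v); rewrite -LD subrr L0.
Qed.

Let W : ugroup_space x :=
  UnitaryGroup L_unitary L0 LD L_continuous.

Lemma ugroup_complete : cvg F.
Proof.
apply/cvg_ex; exists W.
apply/(@metricType_numDomainType.fcvgrPdist_lt R (ugroup_space x)) => e e0.
have e3 : 0 < e / 3 by rewrite divr_gt0.
have [A FA AUV] := udist_cauchy e3.
apply: (filterS _ FA) => U AU; rewrite /mdist/=.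
suff : udist x W U <= e / 3 + e / 3 by lra.
apply: udist_leP => X finX.
have : F (\bigcap_(p in [set` fset_set X]) [set V : ugroup_space x |
    ugap W V p.1.+1 (x p.2) <= e / 3 * hnorm (x p.2)]).
  apply: filter_bigI => p _.
  have := L_unif p.1.+1 (x p.2) (mulr_gt0 e3 (hdseq_gt0 p.2)).
  by apply: filterS => V LV; apply: ugap_leP.
move=> /(filterI FA)/filter_ex[V [AV VX']].
have VX p : X p -> ugap W V p.1.+1 (x p.2) <= e / 3 * hnorm (x p.2).
  by move=> Xp; apply: (VX' p); rewrite /= in_fset_set// inE.
rewrite (@le_trans _ _ (\sum_(p \in X) (w p * (e / 3) + udist_term x V U p)))//.
  apply: le_fsum => // p Xp; rewrite !termE -mulrDr ler_wpM2l ?(ltW (w_gt0 _))//.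
  rewrite -lerBlDr -mulrBl ler_pdivrMr ?hdseq_gt0// (le_trans _ (VX p Xp))//.
  by rewrite lerBlDr ugap_triangle.
rewrite fsbig_split//= lerD//.
  by rewrite -mulr_fsuml ler_piMl ?sum_w// ltW.
by rewrite (le_trans (udist_fsum_ub _ _ finX))// ltW// AUV.
Qed.

End Completeness.

HB.instance Definition _ := Uniform_isComplete.Build (ugroup_space x)
  ugroup_complete.

End UnitaryGroupMetric.

Section Stability.
Context {R : realType} {H : hilbertType R}.
Implicit Type U : unitary_group H.

(* The regular module [R[i]^o] carries the usual topology of the complex
   numbers. *)
Definition weakly_stable U : Prop :=
  forall u v, (inner (U t u) v : R[i]^o) @[t --> +oo] --> 0.

Definition density_one (M : set R) : Prop :=
  fine (lebesgue_measure (M `&` `[0, t])) / t @[t --> +oo] --> (1 : R).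

Definition almost_weakly_stable U : Prop :=
  exists M : set R, [/\ measurable M, M `<=` `[0, +oo[, density_one M &
    forall u v, (inner (U t u) v : R[i]^o) @[t --> within M +oo] --> 0].

End Stability.

Section BaireCategory.
Context {T : topologicalType}.
Implicit Type A : set T.

Definition nowhere_dense A : Prop := (closure A)° = set0.

Definition first_category A : Prop :=
  exists2 F : nat -> set T,
    (forall n, nowhere_dense (F n)) & A = \bigcup_n F n.

Definition residual A : Prop := first_category (~` A).

End BaireCategory.

(* Main.v *)
Require Import Defs.
From mathcomp Require Import all_boot all_order all_algebra.
From mathcomp Require Import finmap complex ring lra.
From mathcomp Require Import all_classical all_reals all_analysis.
From mathcomp Require Import measurable_realfun.

(** Both halves rest on one approximation result: near every unitary group
    there are groups [V] that are diagonal on a finite orthonormal family,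
    with [V t u = u + sum_a (e^(i lam_a t) - 1) <u, g_a> g_a]. Such groups
    are given by finite sums, and their long-time behaviour can be changed
    at will by small perturbations of the frequencies [lam_a], which are
    invisible on a fixed interval of times.

    The approximation ([spectral_approximation]) is finite-dimensional
    linear algebra. The metric only sees finitely many vectors on a compact
    interval ([udist_small]), and by strong continuity only finitely many
    multiples of a small time step [d]. On the finitely many vectors met
    there, the unitary operator [U d] coincides with a unitary operator of a
    finite-dimensional space, obtained by composing Householder reflections
    ([exists_span_extension]), and the spectral theorem for matrices
    diagonalizes it ([exists_eigenbasis]). Choosing the frequencies from
    principal arguments keeps the diagonal group close to [U] between the
    multiples of [d].

    First category: rounding the frequencies to multiples of a small number
    gives a periodic group. So groups that bring every vector back at
    arbitrarily late times are dense, and the closed sets [{U | forall t >=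
    n, |<U t x0, x0>| <= |x0|^2 / 2}], whose union contains all weakly
    stable groups, have empty interior ([weakly_stable_first_category]).

    Residual: since the space has infinite dimension, the eigenvectors of a
    diagonal group can slowly be rotated into an orthogonal copy of their
    span, so the groups that at some time move finitely many given vectors
    to vectors almost orthogonal to all of them are dense; they also form an
    open set. A group [U] in all of these countably many sets
    ([orthogonalizing]) is almost weakly stable
    ([orthogonalizing_almost_weakly_stable]): any orbit contains [m] almost
    orthogonal points [U (s_i) v], and by an approximate Bessel inequality
    [|<U t u, U (s_i) v>| = |<U (t - s_i) u, v>| >= e] holds for a number of
    [i] bounded independently of [m]. Hence [m] translates of the set of
    times [{t | |<U t u, v>| >= e}] overlap boundedly often, and this set
    has density zero. A diagonal argument over the dense sequence merges the
    good times of all pairs of vectors into one set of density one. *)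

Set Implicit Arguments.
Unset Strict Implicit.
Unset Printing Implicit Defensive.

Import Order.TTheory GRing.Theory Num.Theory.
Import numFieldNormedType.Exports.

Local Open Scope classical_set_scope.
Local Open Scope ring_scope.
Local Open Scope complex_scope.

(** * Complex moduli and inner products *)

Section ComplexModulus.
Context {R : realType}.
Implicit Types z w : R[i].

(** The norm on [R[i]] is valued in [R[i]]; [cmod] is the same number seen in
    [R], just as [hnorm] is for vectors, so that all estimates take place in an
    ordered field. *)
Definition cmod z : R := complex.Re `|z|.

Lemma realCM (a b : R) : (a * b)%:C = a%:C * b%:C.
Proof. by rewrite rmorphM. Qed.

Lemma realC_sum (I : finType) (f : I -> R) :
  (\sum_a f a)%:C = \sum_a (f a)%:C.
Proof. by rewrite rmorph_sum. Qed.

Lemma cmodE z : `|z| = (cmod z)%:C.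
Proof. by rewrite RRe_real// ger0_real. Qed.

Lemma cmod_ge0 z : 0 <= cmod z.
Proof. by rewrite -lecR -cmodE normr_ge0. Qed.

Lemma cmod0 : cmod 0 = 0. Proof. by rewrite /cmod normr0. Qed.

Lemma cmodM z w : cmod (z * w) = cmod z * cmod w.
Proof. by apply: complexI; rewrite -cmodE rmorphM/= -!cmodE normrM. Qed.

Lemma cmodN z : cmod (- z) = cmod z.
Proof. by rewrite /cmod normrN. Qed.

Lemma cmodJ z : cmod z^*%C = cmod z.
Proof. by rewrite /cmod normcJ. Qed.

Lemma cmodD z w : cmod (z + w) <= cmod z + cmod w.
Proof. by rewrite -lecR rmorphD/= -!cmodE ler_normD. Qed.

Lemma cmod_real (r : R) : 0 <= r -> cmod r%:C = r.
Proof. by move=> r0; rewrite /cmod ger0_norm// ler0c. Qed.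

Lemma cmod_sqr z : (cmod z ^+ 2)%:C = z * z^*%C.
Proof. by rewrite rmorphXn/= -cmodE sqr_normc. Qed.

Lemma cmod_sum (I : finType) (f : I -> R[i]) :
  cmod (\sum_a f a) <= \sum_a cmod (f a).
Proof.
elim/big_ind2 : _ => [|z r w s zr ws|//]; first by rewrite cmod0.
by rewrite (le_trans (cmodD _ _))// lerD.
Qed.

Lemma cmodRI (a b : R) : cmod (a +i* b) ^+ 2 = a ^+ 2 + b ^+ 2.
Proof. by apply: complexI; rewrite rmorphXn/= -cmodE -add_Re2_Im2. Qed.

End ComplexModulus.

Section Inner.
Context {R : realType} {H : hilbertType R}.
Implicit Types u v w : H.

Lemma innerDl u v w : inner (u + v) w = inner u w + inner v w.
Proof. by have := inner_linearl w 1 u v; rewrite scale1r mul1r. Qed.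

Lemma inner0l w : inner (0 : H) w = 0.
Proof. by rewrite linear0l. Qed.

Lemma innerZl a u w : inner (a *: u) w = a * inner u w.
Proof. by have := inner_linearl w a u 0; rewrite !addr0 inner0l addr0. Qed.

Lemma innerBl u v w : inner (u - v) w = inner u w - inner v w.
Proof. by rewrite innerDl -scaleN1r innerZl mulN1r. Qed.

Lemma inner0r w : inner w (0 : H) = 0.
Proof. by rewrite inner_conj inner0l conjc0. Qed.

Lemma innerDr u v w : inner w (u + v) = inner w u + inner w v.
Proof. by rewrite inner_conj innerDl rmorphD/= -!inner_conj. Qed.

Lemma innerZr a u w : inner w (a *: u) = a^*%C * inner w u.
Proof. by rewrite inner_conj innerZl rmorphM/= -!inner_conj. Qed.

Lemma innerBr u v w : inner w (u - v) = inner w u - inner w v.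
Proof. by rewrite inner_conj innerBl rmorphB/= -!inner_conj. Qed.

Lemma inner_suml (I : finType) (f : I -> H) w :
  inner (\sum_a f a) w = \sum_a inner (f a) w.
Proof.
elim/big_ind2 : _ => [|u z v t uz vt|//]; first by rewrite inner0l.
by rewrite innerDl uz vt.
Qed.

Lemma inner_sumr (I : finType) (f : I -> H) w :
  inner w (\sum_a f a) = \sum_a inner w (f a).
Proof.
elim/big_ind2 : _ => [|u z v t uz vt|//]; first by rewrite inner0r.
by rewrite innerDr uz vt.
Qed.

Lemma hnormZ a u : hnorm (a *: u) = cmod a * hnorm u.
Proof. by apply: complexI; rewrite -normE rmorphM/= -cmodE -normE normrZ. Qed.

Lemma hnorm_opp u : hnorm (- u) = hnorm u.
Proof. by rewrite /hnorm normrN. Qed.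

Lemma hnorm_sum (I : finType) (f : I -> H) :
  hnorm (\sum_a f a) <= \sum_a hnorm (f a).
Proof.
elim/big_ind2 : _ => [|z r w s zr ws|//]; first by rewrite hnorm0.
by rewrite (le_trans (Defs.hnormD _ _))// lerD.
Qed.

(** Expand the squared norm of [|v|^2 u - <u,v> v]; scaling by [|v|^2] instead
    of dividing by it keeps the computation polynomial. *)
Lemma cauchy_schwarz u v : cmod (inner u v) <= hnorm u * hnorm v.
Proof.
have [->|v0] := eqVneq v 0; first by rewrite inner0r cmod0 hnorm0 mulr0.
have hv : 0 < hnorm v.
  rewrite lt_neqAle hnorm_ge0 andbT eq_sym; apply/eqP => /hnorm_eq0/eqP.
  by rewrite (negbTE v0).
rewrite -(@ler_pXn2r _ 2)// ?nnegrE ?mulr_ge0 ?cmod_ge0 ?hnorm_ge0//.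
have s0 : 0 < hnorm v ^+ 2 by rewrite exprn_gt0.
rewrite -(ler_pM2l s0) -lecR.
have : (0 : R[i]) <= (hnorm ((hnorm v ^+ 2)%:C *: u - inner u v *: v) ^+ 2)%:C.
  by rewrite ler0c sqr_ge0.
rewrite -inner_hnorm innerBl !innerBr !innerZl !innerZr (inner_conj u v).
rewrite !inner_hnorm conjc_real exprMn !(realCM (hnorm _ ^+ 2)) cmod_sqr.
move=> h; rewrite -subr_ge0; apply: (le_trans h).
rewrite le_eqVlt; apply/orP; left; apply/eqP; ring.
Qed.

End Inner.

(** * Operators diagonal on a finite orthonormal family *)

Section FiniteRotation.
Context {R : realType} {H : hilbertType R} {I : finType}.
Implicit Types (u v : H) (g : I -> H) (c d : I -> R[i]).

Definition orthonormal_family g := forall a b, inner (g a) (g b) = (a == b)%:R.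

Definition in_span g u := \sum_a inner u (g a) *: g a = u.

(** The operator with eigenvalue [c a] on [g a] that fixes the orthogonal
    complement of the family pointwise. Writing it as a finite perturbation of
    the identity avoids any choice of a complementary basis. *)
Definition diag_op g c u := u + \sum_a ((c a - 1) * inner u (g a)) *: g a.

Variable g : I -> H.
Hypothesis og : orthonormal_family g.

Lemma inner_comb c b : inner (\sum_a c a *: g a) (g b) = c b.
Proof.
rewrite inner_suml (bigD1 b)//= innerZl og eqxx mulr1 big1 ?addr0// => a ab.
by rewrite innerZl og (negbTE ab) mulr0.
Qed.

Lemma in_span_comb c : in_span g (\sum_a c a *: g a).
Proof. by apply: eq_bigr => a _; rewrite inner_comb. Qed.

Lemma hnorm_comb c : hnorm (\sum_a c a *: g a) ^+ 2 = \sum_a cmod (c a) ^+ 2.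
Proof.
apply: complexI; rewrite -inner_hnorm inner_sumr realC_sum.
by apply: eq_bigr => a _; rewrite innerZr inner_comb mulrC cmod_sqr.
Qed.

Lemma orthonormal_hnorm a : hnorm (g a) = 1.
Proof.
apply/eqP; rewrite -(@eqrXn2 _ 2)// ?hnorm_ge0// expr1n.
by apply/eqP/complexI; rewrite -inner_hnorm og eqxx.
Qed.

Lemma inner_diag c u b : inner (diag_op g c u) (g b) = c b * inner u (g b).
Proof. by rewrite innerDl inner_comb mulrBl mul1r addrC subrK. Qed.

Lemma diag_opM c d u :
  diag_op g c (diag_op g d u) = diag_op g (fun a => c a * d a) u.
Proof.
rewrite {1}/diag_op; under eq_bigr do rewrite inner_diag.
rewrite /diag_op -addrA -big_split/=; congr (_ + _); apply: eq_bigr => a _.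
by rewrite -scalerDl; congr (_ *: _); ring.
Qed.

Lemma diag_op1 c u : (forall a, c a = 1) -> diag_op g c u = u.
Proof.
by move=> c1; rewrite /diag_op big1 ?addr0// => a _; rewrite c1 subrr mul0r scale0r.
Qed.

Lemma diag_op_span c u : in_span g u ->
  diag_op g c u = \sum_a (c a * inner u (g a)) *: g a.
Proof.
move=> gu; rewrite /diag_op -[X in X + _]gu -big_split/=; apply: eq_bigr => a _.
by rewrite -scalerDl; congr (_ *: _); ring.
Qed.

Lemma diag_op_linear c : linear (diag_op g c).
Proof.
move=> k u v; rewrite /diag_op scalerDr addrACA scaler_sumr -big_split/=.
congr (_ + _); apply: eq_bigr => a _.
by rewrite innerDl innerZl scalerA -scalerDl; congr (_ *: _); ring.
Qed.

Lemma diag_op_isometry c : (forall a, c a * (c a)^*%C = 1) ->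
  isometry inner inner (diag_op g c).
Proof.
move=> c1 u v; change (inner (diag_op g c u) (diag_op g c v) = inner u v).
rewrite [diag_op g c v]/diag_op innerDr inner_sumr [X in X + _]innerDl.
rewrite inner_suml -addrA -big_split big1 ?addr0//= => a _.
rewrite innerZl innerZr inner_diag rmorphM rmorphB rmorph1/= (inner_conj v (g a)).
transitivity (inner u (g a) * (inner v (g a))^*%C * (c a * (c a)^*%C - 1)).
  by ring.
by rewrite c1 subrr mulr0.
Qed.

End FiniteRotation.

(** * The unit circle *)

Section UnitCircle.
Context {R : realType}.
Implicit Types s t : R.

Definition cis t : R[i] := cos t +i* sin t.

Lemma cis0 : cis 0 = 1.
Proof. by rewrite /cis cos0 sin0. Qed.

Lemma cisD s t : cis (s + t) = cis s * cis t.
Proof.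
rewrite /cis cosD sinD; apply/eqP; rewrite eq_complex /= eqxx/=.
by rewrite [X in _ == X]addrC [cos s * _]mulrC.
Qed.

Lemma cis_conj t : cis t * (cis t)^*%C = 1.
Proof. by rewrite -cmod_sqr cmodRI cos2Dsin2. Qed.

Lemma cmod_cisB s t : cmod (cis s - cis t) ^+ 2 = 2 - 2 * cos (s - t).
Proof.
rewrite /cis cmodRI cosB.
have := cos2Dsin2 s; have := cos2Dsin2 t; lra.
Qed.

(** The bound by [pi] selects the principal argument, on which interpolation
    between powers relies. *)
Lemma cis_polar (z : R[i]) : z * z^*%C = 1 ->
  exists2 t, `|t| <= pi & z = cis t.
Proof.
case: z => a b /(congr1 (@complex.Re R))/= ab.
have {}ab : b ^+ 2 = 1 - a ^+ 2 by move: ab; rewrite mulrN opprK; lra.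
have a1 : -1 <= a <= 1.
  rewrite -ler_norml -(@ler_pXn2r _ 2) ?nnegrE// real_normK ?num_real//.
  by rewrite expr1n -subr_ge0 -ab sqr_ge0.
have ca : cos (acos a) = a by rewrite acosK// in_itv.
have sa : sin (acos a) = `|b| by rewrite sin_acos// -ab sqrtr_sqr.
have pa : `|acos a| <= pi by rewrite ger0_norm ?acos_lepi ?acos_ge0.
have [b0|b0] := leP 0 b.
  by exists (acos a) => //; rewrite /cis ca sa ger0_norm.
by exists (- acos a); rewrite ?normrN// /cis cosN sinN ca sa ltr0_norm// opprK.
Qed.

(** For a principal argument [t], moving along the arc from [1] to [cis t]
    moves away from [1] monotonically, because the cosine decreases on
    [[0, pi]]. *)
Lemma cmod_cis_interpolate s t : `|t| <= pi -> 0 <= s <= 1 ->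
  cmod (cis (s * t) - 1) <= cmod (cis t - 1).
Proof.
move=> tpi /andP[s0 s1].
rewrite -(@ler_pXn2r _ 2)// ?nnegrE ?cmod_ge0// -cis0 !cmod_cisB !subr0.
rewrite lerD2l lerN2 ler_pM2l// -(cos_norm t) -(cos_norm (s * t)).
rewrite normrM ger0_norm//.
rewrite leNgt ltr_cos ?in_itv/=; last 2 first.
- by rewrite normr_ge0.
- by rewrite mulr_ge0//= (le_trans _ tpi)// ler_piMl.
by rewrite -leNgt ler_piMl.
Qed.

Lemma sin_lipschitz t : `|sin t| <= `|t|.
Proof.
suff h (x : R) : 0 <= x -> `|sin x| <= x.
  have [t0|t0] := leP 0 t; first by rewrite (ger0_norm t0) h.
  by rewrite (ltr0_norm t0) -normrN -sinN h// oppr_ge0 ltW.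
move=> x0.
have [c _] := @MVT_segment R sin cos 0 x x0 (fun y _ => is_derive_sin y)
  (continuous_subspaceT (@continuous_sin R)).
rewrite sin0 !subr0 => ->; rewrite normrM (ger0_norm x0).
by rewrite ler_piMl// cos_max.
Qed.

Lemma cis_lipschitz s t : cmod (cis s - cis t) <= `|s - t|.
Proof.
rewrite -(@ler_pXn2r _ 2)// ?nnegrE ?cmod_ge0// cmod_cisB.
have -> : s - t = ((s - t) / 2) *+ 2 by rewrite -mulr_natr divfK.
set x := (s - t) / 2; rewrite cos_mulr2n cos2sin2 normrMn.
have : sin x ^+ 2 <= x ^+ 2.
  rewrite -(real_normK (num_real (sin x))) -(real_normK (num_real x)).
  by rewrite ler_pXn2r ?nnegrE// sin_lipschitz.
by rewrite exprMn_n real_normK ?num_real//; lra.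
Qed.

End UnitCircle.

(** * Diagonal unitary groups *)

Section DiagonalGroup.
Context {R : realType} {H : hilbertType R} {I : finType}.
Implicit Types (u v : H) (g : I -> H) (lam : I -> R).

Definition phase lam (t : R) (a : I) : R[i] := cis (lam a * t).

(** A crude bound, with the [l^1] norm of the difference of the eigenvalues
    instead of its supremum. The family is fixed when the lemma is used, so the
    loss of a factor is harmless. *)
Lemma diag_op_dist g (c d : I -> R[i]) u : orthonormal_family g ->
  hnorm (diag_op g c u - diag_op g d u) <= (\sum_a cmod (c a - d a)) * hnorm u.
Proof.
move=> og.
have ng a : hnorm (g a) = 1 by exact: orthonormal_hnorm.
rewrite opprD addrACA subrr add0r -sumrB (le_trans (hnorm_sum _))// mulr_suml.
apply: ler_sum => a _; rewrite -scalerBl hnormZ ng mulr1 -mulrBl cmodM.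
rewrite opprB addrA subrK ler_wpM2l ?cmod_ge0//.
by rewrite (le_trans (cauchy_schwarz _ _))// ng mulr1.
Qed.

Section Construction.
Variables (g : I -> H) (og : orthonormal_family g) (lam : I -> R).

Let V t := diag_op g (phase lam t).

Let V_unitary t : unitary (V t).
Proof.
split.
- exact: diag_op_linear.
- by apply: diag_op_isometry => // a; exact: cis_conj.
move=> v; exists (V (- t) v); rewrite /V diag_opM// diag_op1// => a.
by rewrite /phase -cisD -mulrDr subrr mulr0 cis0.
Qed.

Let V0 u : V 0 u = u.
Proof. by apply: diag_op1 => a; rewrite /phase mulr0 cis0. Qed.

Let VD s t u : V (s + t) u = V s (V t u).
Proof.
rewrite /V diag_opM//; congr diag_op; apply/funext => a.
by rewrite /phase mulrDr cisD.
Qed.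

Let V_continuous u : continuous (V ^~ u).
Proof.
move=> t; apply/hcvgP => e e0.
pose C := (\sum_a `|lam a|) * hnorm u + 1.
have C0 : 0 < C.
  by rewrite ltr_wpDl// mulr_ge0 ?hnorm_ge0// sumr_ge0.
have /cvgrPdist_lt/(_ (e / C) (divr_gt0 e0 C0)) := @cvg_id _ (nbhs t).
apply: filterS => s; rewrite ltr_pdivlMr// => ts.
rewrite (le_lt_trans (diag_op_dist _ _ _ og))// (le_lt_trans _ ts)//.
apply: (@le_trans _ _ (`|t - s| * (\sum_a `|lam a|) * hnorm u)); last first.
  by rewrite -mulrA ler_wpM2l// lerDl.
rewrite ler_wpM2r ?hnorm_ge0// mulr_sumr; apply: ler_sum => a _.
by rewrite (le_trans (cis_lipschitz _ _))// -mulrBr normrM mulrC.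
Qed.

Definition diag_group : unitary_group H :=
  UnitaryGroup V_unitary V0 VD V_continuous.

End Construction.

End DiagonalGroup.

(** * Finite orthonormalization *)

Section Orthonormalization.
Context {R : realType} {H : hilbertType R}.
Implicit Types (u v w : H) (s : seq H).

Lemma in_span_trans (I J : finType) (g : I -> H) (h : J -> H) u :
  orthonormal_family h -> (forall a, in_span h (g a)) ->
  in_span g u -> in_span h u.
Proof.
move=> oh gh gu; rewrite -gu; under eq_bigr do rewrite -gh scaler_sumr.
rewrite exchange_big/=; under eq_bigr do under eq_bigr do rewrite scalerA.
by under eq_bigr do rewrite -scaler_suml; exact: in_span_comb.
Qed.

Lemma projection_residual (I : finType) (g : I -> H) u b :
  orthonormal_family g -> inner (u - \sum_a inner u (g a) *: g a) (g b) = 0.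
Proof. by move=> og; rewrite innerBl inner_comb// subrr. Qed.

(** One Gram-Schmidt step: what remains of [u] after projection, normalized. *)
Lemma unit_residual (I : finType) (g : I -> H) u :
  orthonormal_family g -> ~ in_span g u ->
  exists w, [/\ inner w w = 1, forall a, inner w (g a) = 0 &
    exists k : R[i], u = \sum_a inner u (g a) *: g a + k *: w].
Proof.
move=> og gu; set p := \sum_a _ *: _; pose r := u - p.
have r0 : hnorm r != 0.
  by apply/eqP => /hnorm_eq0/eqP; rewrite subr_eq0 => /eqP up; apply: gu.
have rC0 : (hnorm r)%:C != 0.
  by rewrite -(rmorph0 (real_complex R)) (inj_eq (@complexI R)).
exists ((hnorm r)%:C^-1 *: r); split.
- rewrite innerZl innerZr inner_hnorm conjc_inv conjc_real expr2 realCM.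
  by rewrite mulKf// mulVf.
- by move=> a; rewrite innerZl projection_residual// mulr0.
by exists (hnorm r)%:C; rewrite scalerA mulfV// scale1r addrC subrK.
Qed.

Lemma gram_schmidt s : exists n (g : 'I_n -> H),
  orthonormal_family g /\ forall u, u \in s -> in_span g u.
Proof.
elim: s => [|u s [n [g [og gs]]]].
  by exists 0%N, (fun=> 0); split => // -[].
have [gu|gu] := pselect (in_span g u).
  by exists n, g; split => // v; rewrite inE => /predU1P[->|/gs].
have [w [w1 wg [k uE]]] := unit_residual og gu.
pose h (i : 'I_n.+1) := if unlift ord0 i is Some j then g j else w.
have h0 : h ord0 = w by rewrite /h unlift_none.
have hS j : h (lift ord0 j) = g j by rewrite /h liftK.
have oh : orthonormal_family h.
  move=> i j; case: (unliftP ord0 i) => [i' ->|->];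
    case: (unliftP ord0 j) => [j' ->|->]; rewrite ?h0 ?hS.
  - by rewrite og (inj_eq lift_inj).
  - by rewrite eq_sym (negbTE (neq_lift _ _)) inner_conj wg conjc0.
  - by rewrite (negbTE (neq_lift _ _)) wg.
  - by rewrite eqxx.
have hg j : in_span h (g j).
  rewrite -hS -[X in in_span _ X](_ : \sum_i (i == lift ord0 j)%:R *: h i = _).
    exact: in_span_comb.
  rewrite (bigD1 (lift ord0 j))//= eqxx scale1r big1 ?addr0// => i /negbTE ->.
  by rewrite scale0r.
exists n.+1, h; split => // v; rewrite inE => /predU1P[->|/gs vs]; last first.
  exact: in_span_trans vs.
pose c (i : 'I_n.+1) := if unlift ord0 i is Some j then inner u (g j) else k.
rewrite -[X in in_span _ X](_ : \sum_i c i *: h i = _); first exact: in_span_comb.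
rewrite big_ord_recl h0 /c unlift_none [RHS]uE addrC; congr (_ + _).
by apply: eq_bigr => i _; rewrite hS liftK.
Qed.

Lemma in_span_orthogonal (I : finType) (g : I -> H) u w :
  in_span g u -> (forall a, inner w (g a) = 0) -> inner w u = 0.
Proof.
move=> <- wg; rewrite inner_sumr big1// => a _.
by rewrite innerZr wg mulr0.
Qed.

Lemma exists_orthogonal_unit s : infinite_dimensional H ->
  exists w, inner w w = 1 /\ forall u, u \in s -> inner w u = 0.
Proof.
move=> hH; have [n [g [og gs]]] := gram_schmidt s.
have [u gu] := hH n g.
have [w [w1 wg _]] := unit_residual og (fun e => gu _ (esym e)).
by exists w; split => // v /gs vs; exact: in_span_orthogonal vs wg.
Qed.

(** Infinite dimension leaves room for a second family, of the same size and
    orthogonal to the first, into which the first can be rotated. *)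
Lemma exists_orthogonal_copy (I : finType) (g : I -> H) :
  infinite_dimensional H -> exists g' : I -> H,
  orthonormal_family g' /\ forall a b, inner (g a) (g' b) = 0.
Proof.
move=> hH.
suff [e [oe eg]] : exists e : nat -> H,
    (forall i j, (i < #|I|)%N -> (j < #|I|)%N -> inner (e i) (e j) = (i == j)%:R)
    /\ (forall a i, (i < #|I|)%N -> inner (g a) (e i) = 0).
  exists (fun a => e (enum_rank a)); split => [a b|a b].
    by rewrite oe ?ltn_ord// (inj_eq val_inj) (inj_eq enum_rank_inj).
  by rewrite eg ?ltn_ord.
elim: #|I| => [|k [e [oe eg]]]; first by exists (fun=> 0); split.
have [w [w1 ws]] := exists_orthogonal_unit (codom g ++ map e (iota 0 k)) hH.
have we i : (i < k)%N -> inner w (e i) = 0.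
  by move=> ik; rewrite ws// mem_cat map_f ?orbT// mem_iota.
have wg a : inner w (g a) = 0 by rewrite ws// mem_cat codom_f.
exists (fun i => if i == k then w else e i); split => [i j|a i];
  rewrite !ltnS; last first.
  rewrite leq_eqVlt; case: eqVneq => [_ _|_ /= ik]; last exact: eg.
  by rewrite inner_conj wg conjc0.
rewrite leq_eqVlt (leq_eqVlt j).
case: (eqVneq i k) => [-> _|ik /= ilt]; case: (eqVneq j k) => [-> _|jk /= jlt].
- by rewrite w1.
- by rewrite we.
- by rewrite inner_conj we// conjc0 (negbTE ik).
- exact: oe.
Qed.

End Orthonormalization.

(** * Diagonalizing a unitary operator on finitely many vectors *)

Section FiniteDiagonalization.
Context {R : realType} {H : hilbertType R}.
Implicit Types (u v w : H) (T D : H -> H).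

Lemma linear_comb (I : finType) (D : H -> H) (c : I -> R[i]) (g : I -> H) :
  linear D -> D (\sum_a c a *: g a) = \sum_a c a *: D (g a).
Proof.
move=> linD; have D0 : D 0 = 0.
  by have := linD (- 1) 0 0; rewrite scaler0 addr0 scaleN1r addNr.
elim/big_ind2 : _ => [//|u u' v v' <- <-|a _].
  by have := linD 1 u' v'; rewrite !scale1r.
by have := linD (c a) (g a) 0; rewrite !addr0 D0 addr0.
Qed.

(** A complex Householder reflection: multiply the component along [v - w] by
    [c] and fix the orthogonal complement of [v - w]. With [a = <v, v - w>], the
    equality of norms gives [|v - w|^2 = a + a^*], so the factor that sends [v]
    to [w] is [c = - a^* / a], of modulus one. *)
Lemma exists_reflection v w : hnorm v = hnorm w -> exists D,
  [/\ linear D, isometry inner inner D, D v = w,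
    forall u, inner u (v - w) = 0 -> D u = u &
    forall (I : finType) (g : I -> H) u, orthonormal_family g ->
      in_span g v -> in_span g w -> in_span g u -> in_span g (D u)].
Proof.
move=> vw; have [<-|vNw] := eqVneq v w.
  by exists id; split.
pose N := (hnorm (v - w))%:C; pose a := inner v (v - w).
have N0 : N != 0.
  rewrite -(rmorph0 (real_complex R)) (inj_eq (@complexI R)).
  by apply: contra vNw => /eqP/hnorm_eq0/eqP; rewrite subr_eq0.
(* Here the equality of the norms of v and w is used. *)
have NN : N * N = a + a^*%C.
  rewrite -realCM -expr2 -inner_hnorm innerBl -/a; congr (_ + _).
  rewrite /a !innerBr rmorphB/= -!inner_conj !inner_hnorm vw.
  by rewrite opprB.
have a0 : a != 0.
  apply: contra_neq N0 => a0; move: NN; rewrite a0 conjc0 addr0 => /eqP.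
  by rewrite mulf_eq0 orbb => /eqP.
pose e (_ : unit) := N^-1 *: (v - w).
pose c (_ : unit) := - (a^*%C / a).
have Nr : (N^-1)^*%C = N^-1 by rewrite conjc_inv conjc_real.
have oe : orthonormal_family e.
  move=> [] []; rewrite innerZl innerZr Nr inner_hnorm expr2 realCM -/N.
  by rewrite mulKf// mulVf.
have c1 b : c b * (c b)^*%C = 1.
  rewrite /c rmorphN/= mulrNN rmorphM/= conjc_inv conjcK mulf_div (mulrC a).
  by rewrite divff// mulf_neq0// conjc_eq0.
have DE u : diag_op e c u =
    u - ((a^*%C / a + 1) * inner u (v - w) / (N * N)) *: (v - w).
  rewrite /diag_op (bigD1 tt)//= big1 ?addr0; last by case.
  rewrite -scaleNr; congr (_ + _).
  rewrite /e innerZr Nr scalerA; congr (_ *: _); rewrite /c invfM.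
  by ring.
exists (diag_op e c); split.
- exact: diag_op_linear.
- exact: diag_op_isometry.
- rewrite DE -/a (_ : _ * a = N * N); last first.
    by rewrite NN mulrDl mul1r divfK// addrC.
  by rewrite divff ?mulf_neq0// scale1r subKr.
- by move=> u uvw; rewrite DE uvw mulr0 mul0r scale0r subr0.
move=> I g u og gv gw gu; rewrite DE.
rewrite -gu -[in X in _ - X]gv -[in X in _ - X]gw -!sumrB scaler_sumr -sumrB.
by under eq_bigr do rewrite -scalerBl scalerA -scalerBl; exact: in_span_comb.
Qed.

(** Composing reflections extends the isometry [T], known on the vectors of [s]
    only, to an isometry of a finite-dimensional space containing [s] and its
    image. The reflection that corrects the value at the next vector [y] fixes
    the values already obtained: for [u] in [s], [T u] is orthogonal to
    [D y - T y], since both [D] and [T] preserve the inner product of [u] and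
    [y]. *)
Lemma exists_span_extension (I : finType) (g : I -> H) T (s : seq H) :
  orthonormal_family g -> isometry inner inner T ->
  (forall u, u \in s -> in_span g u /\ in_span g (T u)) ->
  exists D, [/\ linear D, isometry inner inner D,
    forall u, in_span g u -> in_span g (D u) &
    forall u, u \in s -> D u = T u].
Proof.
move=> og isoT; elim: s => [_|y s IH gs].
  by exists id; split.
have [u us|D [linD isoD gD DT]] := IH.
  by apply: gs; rewrite inE us orbT.
have [gy gTy] := gs y (mem_head _ _).
have nE : hnorm (D y) = hnorm (T y).
  apply/eqP; rewrite -(@eqrXn2 _ 2)// ?hnorm_ge0//; apply/eqP/complexI.
  by rewrite -!inner_hnorm; exact: etrans (isoD y y) (esym (isoT y y)).
have [E [linE isoE Ey fixE gE]] := exists_reflection nE.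
exists (E \o D); split.
- by move=> k u v; rewrite /= linD linE.
- by move=> u v; rewrite /= [LHS]isoE; exact: isoD.
- by move=> u gu; apply: gE => //; exact: gD.
move=> u /=; rewrite inE => /predU1P[->//|us].
rewrite DT// fixE// innerBr -{1}DT//.
by rewrite [X in X - _]isoD [X in _ - X]isoT subrr.
Qed.

End FiniteDiagonalization.

Section Diagonalization.
Context {R : realType} {H : hilbertType R}.
Implicit Types (u v w : H) (T D : H -> H).
Local Open Scope sesquilinear_scope.

(** The matrix of [D] in the orthonormal family [g] is unitary, hence normal,
    and the spectral theorem for matrices provides the rows of [h]. *)
Lemma exists_eigenbasis n (g : 'I_n -> H) D :
  orthonormal_family g -> linear D -> isometry inner inner D ->
  (forall u, in_span g u -> in_span g (D u)) ->
  exists (h : 'I_n -> H) (c : 'I_n -> R[i]),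
    [/\ orthonormal_family h, forall i, c i * (c i)^*%C = 1 &
        forall u, in_span g u -> in_span h u /\ D u = diag_op h c u].
Proof.
move=> og linD isoD gD.
have gg i : in_span g (g i).
  rewrite -[X in in_span _ X](_ : \sum_j (j == i)%:R *: g j = _).
    exact: in_span_comb.
  rewrite (bigD1 i)//= eqxx scale1r big1 ?addr0// => j /negbTE ->.
  by rewrite scale0r.
pose A := \matrix_(i, j) inner (D (g i)) (g j).
have AE i : D (g i) = \sum_j A i j *: g j.
  by rewrite -[LHS](gD _ (gg i)); apply: eq_bigr => j _; rewrite mxE.
have inner_rows (p q : 'I_n -> R[i]) (f : 'I_n -> H) : orthonormal_family f ->
    inner (\sum_k p k *: f k) (\sum_k q k *: f k) = \sum_k p k * (q k)^*%C.
  move=> of_; rewrite inner_sumr; apply: eq_bigr => k _.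
  by rewrite innerZr inner_comb// mulrC.
have uA : A \is unitarymx.
  apply/unitarymxP/matrixP => i j; rewrite !mxE -og.
  transitivity (inner (D (g i)) (D (g j))); last exact: isoD.
  rewrite !AE inner_rows//.
  by apply: eq_bigr => k _; rewrite !mxE.
have nA : A \is normalmx.
  apply/normalmxP; rewrite (unitarymxP uA); apply/esym/mulmx1C/unitarymxP.
  exact: uA.
have /orthomx_spectralP := nA.
set P := spectralmx A; set d := spectral_diag A => AP.
have uP : P \is unitarymx := spectral_unitarymx A.
have PA : P *m A = diag_mx d *m P.
  by rewrite [in LHS]AP !mulmxA mulmxV ?mul1mx// spectral_unit.
pose h i := \sum_j P i j *: g j.
have oh : orthonormal_family h.
  move=> i j; rewrite /h inner_rows//.
  have /matrixP/(_ i j) := unitarymxP uP; rewrite !mxE => <-.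
  by apply: eq_bigr => k _; rewrite !mxE.
have Dh i : D (h i) = d 0 i *: h i.
  rewrite /h linear_comb//; under eq_bigr do rewrite AE scaler_sumr.
  rewrite exchange_big/= scaler_sumr; apply: eq_bigr => k _.
  rewrite scalerA; have /matrixP/(_ i k) := PA.
  rewrite mul_diag_mx !mxE => <-; rewrite scaler_suml.
  by apply: eq_bigr => j _; rewrite scalerA.
have PP j k : \sum_i (P i j)^*%C * P i k = (k == j)%:R.
  have /matrixP/(_ j k) := mulmx1C (unitarymxP uP).
  rewrite !mxE eq_sym => <-.
  by apply: eq_bigr => i _; rewrite !mxE.
have hg j : in_span h (g j).
  rewrite -[X in in_span _ X](_ : \sum_i (P i j)^*%C *: h i = _).
    exact: in_span_comb.
  rewrite /h; under eq_bigr do rewrite scaler_sumr.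
  rewrite exchange_big/=.
  transitivity (\sum_k (k == j)%:R *: g k).
    apply: eq_bigr => k _; under eq_bigr do rewrite scalerA.
    by rewrite -scaler_suml PP.
  rewrite (bigD1 j)//= eqxx scale1r big1 ?addr0// => k /negbTE ->.
  by rewrite scale0r.
exists h, (d 0); split => //.
  move=> i; have : inner (D (h i)) (D (h i)) = inner (h i) (h i) := isoD _ _.
  by rewrite Dh innerZl innerZr oh eqxx mulr1.
move=> u gu; have hu := in_span_trans oh hg gu; split => //.
rewrite diag_op_span// -[in LHS]hu linear_comb//; apply: eq_bigr => i _.
by rewrite Dh scalerA mulrC.
Qed.

End Diagonalization.

Section Approximation.
Context {R : realType} {H : hilbertType R}.
Implicit Types (u v w : H) (U V : unitary_group H).

(** On any finite set of vectors, a unitary operator coincides exactly with one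
    that is diagonal on a finite orthonormal family. This replaces the spectral
    theorem for the generator of the group. *)
Lemma exists_diag_extension (T : H -> H) (s : seq H) :
  isometry inner inner T -> exists n (h : 'I_n -> H) (lam : 'I_n -> R),
  [/\ orthonormal_family h, forall i, `|lam i| <= pi &
      forall u, u \in s -> in_span h u /\ T u = diag_op h (cis \o lam) u].
Proof.
move=> isoT; have [n [g [og gs]]] := gram_schmidt (s ++ map T s).
have sg u : u \in s -> in_span g u /\ in_span g (T u).
  by move=> us; split; apply: gs; rewrite mem_cat ?us// map_f ?orbT.
have [D [linD isoD gD DT]] := exists_span_extension og isoT sg.
have [h [c [oh c1 hg]]] := exists_eigenbasis og linD isoD gD.
have /choice[lam lamP] i : exists t, `|t| <= pi /\ c i = cis t.
  by have [t tpi ct] := cis_polar (c1 i); exists t.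
exists n, h, lam; split => // [i|u us]; first exact: (lamP i).1.
have [hu Du] := hg u (sg u us).1; split => //.
rewrite -DT// Du; congr diag_op; apply/funext => i; exact: (lamP i).2.
Qed.

Lemma ugroup_isometry U t : isometry inner inner (U t).
Proof. by have [] := ugroup_unitary U t. Qed.

(** Within a step of length [delta], the diagonal group with principal
    arguments displaces a vector at most as much as the full step does. *)
Lemma diag_group_interpolate n (h : 'I_n -> H) (oh : orthonormal_family h)
    (lam : 'I_n -> R) (delta r : R) u : 0 < delta -> 0 <= r <= delta ->
  (forall i, `|lam i| <= pi) ->
  hnorm (diag_group oh (fun i => lam i / delta) r u - u) <=
  hnorm (diag_op h (cis \o lam) u - u).
Proof.
move=> d0 /andP[r0 rd] lampi.
rewrite -(@ler_pXn2r _ 2)// ?nnegrE ?hnorm_ge0// /= /diag_op.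
rewrite ![u + _]addrC !addrK !hnorm_comb//.
apply: ler_sum => i _; rewrite ler_pXn2r ?nnegrE ?cmod_ge0// !cmodM.
rewrite ler_wpM2r ?cmod_ge0//= /phase.
rewrite (_ : _ / _ * _ = r / delta * lam i); last first.
  by field; rewrite gt_eqF.
rewrite cmod_cis_interpolate// divr_ge0 ?(ltW d0)//=.
by rewrite ler_pdivrMr// mul1r.
Qed.

End Approximation.

(** * Approximating a unitary group by diagonal groups *)

Section SpectralApproximation.
Context {R : realType} {H : hilbertType R}.
Implicit Types (u v w : H) (U V : unitary_group H).

Lemma ugroup_modulus U (s : seq H) (e : R) : 0 < e ->
  exists2 d : R, 0 < d & forall u r, u \in s -> `|r| <= d ->
    hnorm (U r u - u) <= e.
Proof.
move=> e0; elim: s => [|v s [d d0 ds]]; first by exists 1.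
have /hcvgP/(_ e e0) := @ugroup_continuous _ _ U v 0.
rewrite ugroup0 => /nbhs_norm0P[d' /= d'0 d'v].
exists (Num.min d (d' / 2)); first by rewrite lt_min d0 divr_gt0.
move=> u r; rewrite inE le_min => /predU1P[->|us] /andP[rd rd']; last exact: ds.
rewrite hdistC ltW// d'v//= (le_lt_trans rd')// ltr_pdivrMr// ltr_pMr//.
by rewrite ltr1n.
Qed.

(** Choose a step [d = N / P] during which [U] moves the given vectors by at most
    [e / 2], and a diagonal group [V] whose step [V d] agrees with [U d] on the
    whole orbit segment [U (k d) u], [-P <= k < P]. Then [U] and [V] agree at all
    multiples of [d] in [[-N, N]], and between two multiples each group moves
    [u] by at most [e / 2], by the choice of [d] for [U] and by interpolation
    for [V]. *)
Lemma spectral_approximation U (s : seq H) (N e : R) : 0 < N -> 0 < e ->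
  exists n (h : 'I_n -> H) (oh : orthonormal_family h) (lam : 'I_n -> R),
  forall u, u \in s -> in_span h u /\ forall t, `|t| <= N ->
    hnorm (U t u - diag_group oh lam t u) <= e.
Proof.
move=> N0 e0; have e20 : 0 < e / 2 by rewrite divr_gt0.
have [d0 d00 sd0] := ugroup_modulus U s e20.
(* The number of steps is fixed first, so that the steps divide [0, N] evenly. *)
pose P := (Num.trunc (N / d0)).+1; pose d := N / P%:R.
have P0 : 0 < P%:R :> R by rewrite ltr0n.
have d_gt0 : 0 < d by rewrite divr_gt0.
have dd0 : d <= d0.
  by rewrite ler_pdivrMr// -ler_pdivrMl// mulrC ltW// truncnS_gt.
have PdN : P%:R * d = N by rewrite mulrC divfK// gt_eqF.
pose y p u := U ((p%:R - P%:R) * d) u.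
pose ys := [seq y p u | p <- iota 0 (P + P), u <- s].
have [n [h [lam [oh lampi hys]]]] :=
  exists_diag_extension ys (ugroup_isometry U d).
exists n, h, oh, (fun i => lam i / d) => u us.
set V := diag_group oh _.
have Vd w : V d w = diag_op h (cis \o lam) w.
  rewrite /= /phase; congr diag_op; apply/funext => i /=.
  by rewrite divfK// gt_eqF.
(* Shifting the segment to start at time - N makes the induction run forward. *)
have yP p : (p < P + P)%N -> y p u \in ys.
  by move=> pP; apply/allpairsP; exists (p, u); split => //; rewrite mem_iota.
have Vy p : (p <= P + P)%N -> V (p%:R * d) (y 0%N u) = y p u.
  elim: p => [_|p IH pP]; first by rewrite mul0r ugroup0.
  rewrite -natr1 mulrDl mul1r addrC ugroupD IH ?(ltnW pP)// Vd.
  have [_ <-] := hys _ (yP _ pP).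
  by rewrite /y -ugroupD -natr1; congr (U _ _); ring.
have yPu : y P u = u by rewrite /y subrr mul0r ugroup0.
have Vq p : (p <= P + P)%N -> V ((p%:R - P%:R) * d) u = y p u.
  move=> pP; rewrite -[in LHS]yPu -Vy ?leq_addr// -ugroupD -mulrDl subrK.
  exact: Vy.
have hu : in_span h u.
  by rewrite -yPu; apply: (hys _ (yP _ _)).1; rewrite -addn1 leq_add2l.
split => // t; rewrite ler_norml => /andP[Nt tN].
have tN0 : 0 <= (t + N) / d by rewrite divr_ge0 ?(ltW d_gt0)// -lerBlDr sub0r.
pose p := Num.trunc ((t + N) / d); pose r := t + N - p%:R * d.
have /andP[pt tp] : p%:R <= (t + N) / d < p.+1%:R by exact: truncn_itv.
have r0 : 0 <= r by rewrite subr_ge0 -ler_pdivlMr.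
have rd : r <= d.
  by rewrite ltW// ltrBlDl -{2}[d]mul1r -mulrDl natr1 -ltr_pdivrMr.
have pP : (p <= P + P)%N.
  rewrite -(ler_nat R) (le_trans pt)// ler_pdivrMr// natrD mulrDl PdN.
  by rewrite lerD2r.
have -> : t = (p%:R - P%:R) * d + r by rewrite mulrBl PdN /r; ring.
(* As a let-bound difference, r would be taken apart as a sum of times. *)
clearbody r.
have := Vq _ pP; rewrite /y; set q := _ * d => VUq.
rewrite !ugroupD (le_trans (hdist_triangle (U q u) _ _))//.
rewrite -[in X in _ + hnorm X]VUq -!ugroupB !hnorm_ugroup.
rewrite [leRHS]splitr lerD//.
  by rewrite sd0// ger0_norm// (le_trans rd).
have rd' : 0 <= r <= d by rewrite r0.
rewrite hdistC (le_trans (diag_group_interpolate oh u d_gt0 rd' lampi))//.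
rewrite -Vd (_ : V d u = U d u) ?sd0// ?(gtr0_norm d_gt0)//.
have := Vq P.+1; rewrite -addn1 leq_add2l => /(_ isT).
by rewrite /y natrD [_ + 1%:R]addrC addrK mul1r.
Qed.

End SpectralApproximation.

(** * Neighbourhoods for the metric *)

Section MetricNeighborhoods.
Context {R : realType} {H : hilbertType R} (x : dense_sequence H).
Implicit Types U V : unitary_group H.

(** The factor [k <= n] is a Boolean read as a number, so that the tail and the
    full sum ([k = 0]) are instances of the same bound. *)
Lemma dyadic_tail k L :
  \sum_(n < L) (k <= n)%:R * (2 ^- n.+1 : R) <= 2 ^- k.
Proof.
suff <- : \sum_(n < L) (k <= n)%:R * (2 ^- n.+1 : R) + 2 ^- maxn k L = 2 ^- k.
  by rewrite lerDl invr_ge0 exprn_ge0.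
elim: L => [|L IH]; first by rewrite big_ord0 add0r maxn0.
rewrite big_ord_recr/= -IH -addrA; congr (_ + _).
have [kL|Lk] := leqP k L.
  rewrite (maxn_idPr (leqW kL)) mul1r exprS invfM.
  by set z := 2 ^- L; lra.
by rewrite (maxn_idPl Lk) mul0r add0r.
Qed.

Lemma udist_term_le U V n j (e : R) :
  (forall t, `|t| <= n.+1%:R -> hnorm (U t (x j) - V t (x j)) <= e * hnorm (x j)) ->
  udist_term x U V (n, j) <= 2 ^- n.+1 * 2 ^- j.+1 * e.
Proof.
move=> UV; rewrite /udist_term/= ler_pdivrMr ?mulr_gt0 ?exprn_gt0 ?hdseq_gt0//.
rewrite [leRHS](_ : _ = e * hnorm (x j)); last first.
  by rewrite exprD; field; rewrite !expf_neq0.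
by apply: ugap_leP => t; rewrite in_itv/= -ler_norml; exact: UV.
Qed.

(** The metric is controlled by finitely many vectors on a compact interval of
    times: every term is at most twice its dyadic weight, and the weights of
    the pairs with an index beyond [k] add up to at most [2 * 2 ^- k]. *)
Lemma udist_small (e : R) : 0 < e -> exists k, exists2 d : R, 0 < d &
  forall U V, (forall j t, (j < k)%N -> `|t| <= k%:R ->
    hnorm (U t (x j) - V t (x j)) <= d) -> udist x U V < e.
Proof.
move=> e0; have e40 : 0 < e / 4 by rewrite divr_gt0.
pose k := (Num.trunc (16 / e)).+1.
have ke : 4 * 2 ^- k <= e / 4 :> R.
  have k16 : 16 / e < 2 ^+ k.
    by rewrite (lt_trans (truncnS_gt _))// -natrX ltr_nat ltn_expl.
  rewrite ler_pdivrMr ?exprn_gt0// mulrC -ler_pdivrMr//.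
  by rewrite (le_trans _ (ltW k16))// invf_div mulrA -natrM.
have /(_ k)[d d0 dk] m : exists2 d : R, 0 < d &
    forall j, (j < m)%N -> d <= e / 4 * hnorm (x j).
  elim: m => [|m [d d0 dm]]; first by exists 1.
  exists (Num.min d (e / 4 * hnorm (x m))).
    by rewrite lt_min d0 mulr_gt0// hdseq_gt0.
  move=> j; rewrite ltnS leq_eqVlt => /predU1P[->|/dm dj].
    by rewrite ge_min lexx orbT.
  by rewrite ge_min dj.
exists k, d => // U V UV.
pose a n : R := 2 ^- n.+1.
pose f n j : R := a n * a j * (e / 4 + (k <= n)%:R * 2 + (k <= j)%:R * 2).
have a0 n : 0 <= a n by rewrite invr_ge0 exprn_ge0.
have f0 n j : 0 <= f n j.
  by rewrite mulr_ge0 ?mulr_ge0// !addr_ge0 ?(ltW e40)// mulr_ge0.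
have termf n j : udist_term x U V (n, j) <= f n j.
  apply: udist_term_le => t tn.
  have UVx : hnorm (U t (x j) - V t (x j)) <= 2 * hnorm (x j).
    rewrite (le_trans (hdist_triangle 0 _ _))// subr0 sub0r hnorm_opp.
    by rewrite !hnorm_ugroup mulrDl mul1r.
  have [/andP[nk jk]|nkj] := boolP ((n < k)%N && (j < k)%N).
    rewrite (le_trans _ (le_trans (dk _ jk) _)) ?UV//.
      by rewrite (le_trans tn)// ler_nat.
    by rewrite ler_wpM2r ?hnorm_ge0// -addrA lerDl addr_ge0// mulr_ge0.
  rewrite (le_trans UVx)// ler_wpM2r ?hnorm_ge0//.
  by move: nkj; rewrite negb_and -!leqNgt => /orP[]->; case: (k <= _)%N;
    rewrite ?mulr1n ?mulr0n ?mul1r ?mul0r; move: e40; lra.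
apply: (@le_lt_trans _ _ (e / 4 + 4 * 2 ^- k)); last lra.
apply: udist_leP => X finX.
rewrite fsbig_finite//=; set s : seq (nat * nat) := fset_set X.
have us : uniq s by exact: fset_uniq.
have [L sL] : exists L, forall p, p \in s -> (p.1 < L)%N && (p.2 < L)%N.
  elim: s {us} => [|q s [L IH]]; first by exists 0%N.
  exists (maxn L (maxn q.1 q.2).+1) => p; rewrite inE => /predU1P[->|/IH].
    by rewrite !leq_max !ltnS leq_maxl leq_maxr !orbT.
  by move=> /andP[p1 p2]; rewrite !leq_max p1 p2.
have sumf : \sum_(n < L) \sum_(j < L) f n j <= e / 4 + 4 * 2 ^- k.
  have A1 := dyadic_tail 0 L; have Ak := dyadic_tail k L.
  rewrite expr0 invr1 in A1.
  set A := \sum_(n < L) _ in A1; set B := \sum_(n < L) _ in Ak.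
  have A0 : 0 <= A by apply: sumr_ge0 => n _; rewrite mulr_ge0.
  have B0 : 0 <= B by apply: sumr_ge0 => n _; rewrite mulr_ge0.
  rewrite (_ : \sum_(n < L) _ = A * A * (e / 4) + B * A * 2 + A * B * 2).
    have AA : A * A <= 1 by rewrite mulr_ile1.
    have AB : A * B <= 2 ^- k by rewrite (le_trans _ Ak)// ler_piMl.
    have := ler_wpM2r (ltW e40) AA; rewrite mul1r (mulrC B A); lra.
  rewrite /A /B !big_distrlr/= !mulr_suml -!big_split/=; apply: eq_bigr => n _.
  rewrite !mulr_suml -!big_split/=; apply: eq_bigr => j _.
  by rewrite /f /a !mul1r; ring.
apply: le_trans sumf.
rewrite (le_trans (ler_sum _ (fun p _ => termf p.1 p.2)))//.
rewrite pair_big/= -(big_map (fun p : 'I_L * 'I_L => (val p.1, val p.2)) xpredT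
  (fun p => f p.1 p.2)).
set s' := map _ _.
have us' : uniq s'.
  rewrite map_inj_uniq ?index_enum_uniq// => -[n j] [n' j'] [].
  by move=> /val_inj -> /val_inj ->.
have ss' : {subset s <= s'}.
  move=> [n j] /sL/andP[/= nL jL]; apply/mapP.
  by exists (Ordinal nL, Ordinal jL); rewrite ?mem_index_enum.
have fs : perm_eq [seq p <- s' | p \in s] s.
  rewrite uniq_perm ?filter_uniq// => p; rewrite mem_filter.
  by have [/ss'|] := boolP (p \in s).
rewrite [leRHS](bigID (mem s))/= -[X in _ <= X + _]big_filter (perm_big _ fs).
by rewrite lerDl sumr_ge0.
Qed.

End MetricNeighborhoods.

(** * Perturbing the frequencies of a diagonal group *)

Section Perturbation.
Context {R : realType} {H : hilbertType R}.
Implicit Types (u v w : H) (U V : unitary_group H).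

Lemma diag_perturbation (I : finType) (g : I -> H) (og : orthonormal_family g)
    (y : nat -> H) K (d : R) : 0 < d -> exists2 c : R, 0 < c &
  forall lam mu : I -> R, (forall a, `|lam a - mu a| <= c) ->
  forall j t, (j < K)%N -> `|t| <= K%:R ->
    hnorm (diag_group og lam t (y j) - diag_group og mu t (y j)) <= d.
Proof.
move=> d0; pose B := 1 + \sum_(j < K) hnorm (y j).
have B0 : 0 < B by rewrite ltr_pwDl// sumr_ge0// => j _; exact: hnorm_ge0.
have yB j : (j < K)%N -> hnorm (y j) <= B.
  move=> jK; rewrite /B (bigD1 (Ordinal jK))//= addrCA lerDl.
  by rewrite addr_ge0// sumr_ge0// => i _; exact: hnorm_ge0.
pose M := #|I|.+1%:R * K.+1%:R * B.
have M0 : 0 < M by rewrite !mulr_gt0.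
exists (d / M); first by rewrite divr_gt0.
move=> lam mu lm j t jK tK; rewrite (le_trans (diag_op_dist _ _ _ og))//.
have dM0 : 0 <= d / M by rewrite divr_ge0 ?ltW.
rewrite (_ : d = #|I|.+1%:R * (d / M * K.+1%:R) * B); last first.
  by rewrite /M; field; rewrite !gt_eqF// ?ltr0n.
rewrite ler_pM ?hnorm_ge0 ?yB ?sumr_ge0// => [a _|]; first exact: cmod_ge0.
apply: (@le_trans _ _ (\sum_(a in I) (d / M * K.+1%:R))).
  apply: ler_sum => a _; rewrite (le_trans (cis_lipschitz _ _))// -mulrBl normrM.
  by rewrite ler_pM// (le_trans tK)// ler_nat.
by rewrite sumr_const -[leLHS]mulr_natl ler_wpM2r ?ler_nat// mulr_ge0.
Qed.

End Perturbation.

Section PeriodicGroups.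
Context {R : realType} {H : hilbertType R}.

Lemma cis_2pi_nat n : cis (n%:R * (pi *+ 2)) = 1 :> R[i].
Proof.
elim: n => [|n IH]; first by rewrite mul0r cis0.
by rewrite -natr1 mulrDl mul1r cisD IH mul1r /cis cos2pi sin2pi.
Qed.

Lemma cis_2pi_int (z : int) : cis (z%:~R * (pi *+ 2)) = 1 :> R[i].
Proof.
case: z => n; first exact: cis_2pi_nat.
rewrite NegzE mulrNz mulNr -pmulrn.
set s := _ * _; have := cisD (- s) s.
by rewrite addNr cis0 {3}/s cis_2pi_nat mulr1.
Qed.

(** When all frequencies are multiples of [c], every multiple of [2 pi / c] is a
    period. *)
Lemma diag_group_recurrent (I : finType) (g : I -> H) (og : orthonormal_family g)
    (c T : R) (z : I -> int) u : 0 < c ->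
  exists2 t, T <= t & diag_group og (fun a => c * (z a)%:~R) t u = u.
Proof.
move=> c0; pose m := (Num.trunc (`|T| * c)).+1.
exists (m%:R * (pi *+ 2) / c).
  rewrite (le_trans (ler_norm _))// ler_pdivlMr//.
  rewrite (le_trans (ltW (truncnS_gt _)))// ler_peMr//.
  by have := @pi_ge2 R; lra.
apply: diag_op1 => a; rewrite /phase -[RHS](cis_2pi_int (z a * m)).
by congr cis; rewrite intrM; field; rewrite gt_eqF.
Qed.

Lemma floor_round (c l : R) : 0 < c -> `|l - c * (Num.floor (l / c))%:~R| <= c.
Proof.
move=> c0; have /andP[] := floor_itv (l / c).
set f := (Num.floor _)%:~R; rewrite intrD -/f ler_pdivlMr// ltr_pdivrMr//.
by move=> fl lf; rewrite ler_norml; apply/andP; split; lra.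
Qed.

End PeriodicGroups.

Lemma inner_diag_group (R : realType) (H : hilbertType R) (I : finType)
    (g : I -> H) (og : orthonormal_family g) (lam : I -> R) t u a :
  inner (diag_group og lam t u) (g a) = cis (lam a * t) * inner u (g a).
Proof. exact: inner_diag. Qed.

(** The span of [h] is rotated into the span of the orthogonal copy [h'] by the
    group whose eigenvectors are [(h a + h' a) / sqrt 2] and
    [(h a - h' a) / sqrt 2], with frequencies split by [+ c] and [- c]: a vector
    [h a] becomes orthogonal to the span of [h] after a quarter turn, at time
    [pi / (2 c)]. *)
Section Rotation.
Context {R : realType} {H : hilbertType R} {I : finType}.
Implicit Types (u v w : H).
Variables h h' : I -> H.
Hypotheses (oh : orthonormal_family h) (oh' : orthonormal_family h').
Hypothesis hh' : forall a b, inner (h a) (h' b) = 0.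

Let r : R[i] := ((Num.sqrt 2)^-1)%:C.

Let r2 : r * r = 2^-1.
Proof.
rewrite /r -realCM -expr2 exprVn sqr_sqrtr// fmorphV/=.
by congr (_^-1); rewrite rmorph_nat.
Qed.

Let rJ : r^*%C = r. Proof. exact: conjc_real. Qed.

(** The Boolean is the exponent of the sign in front of [h']. *)
Definition half_sum (p : I * bool) : H :=
  r *: (h p.1 + (-1) ^+ p.2 *: h' p.1).

Let h'h a b : inner (h' a) (h b) = 0.
Proof. by rewrite inner_conj hh' conjc0. Qed.

Lemma half_sum_orthonormal : orthonormal_family half_sum.
Proof.
move=> [a s] [b s']; rewrite /half_sum/= innerZl innerZr mulrA rJ r2.
have sJ : ((-1) ^+ s')^*%C = (-1) ^+ s' :> R[i].
  by rewrite rmorphXn rmorphN rmorph1.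
rewrite innerDl !innerDr !innerZl !innerZr hh' h'h oh oh' sJ !mulr0 addr0 add0r.
rewrite xpair_eqE; case: eqVneq => _ /=; last by rewrite !mulr0 addr0 mulr0.
by case: s s' {sJ} => [] []; rewrite ?expr0 ?expr1 ?eqxx /=; field.
Qed.

Let inner_half_sum u a s : in_span h u ->
  inner u (half_sum (a, s)) = r * inner u (h a).
Proof.
move=> hu; have u0 : inner u (h' a) = 0.
  by rewrite inner_conj (in_span_orthogonal hu (h'h a)) conjc0.
by rewrite /half_sum innerZr innerDr innerZr rJ u0 mulr0 addr0.
Qed.

Let half_sumD a : h a = r *: half_sum (a, true) + r *: half_sum (a, false).
Proof.
rewrite /half_sum/= !scalerA r2 -scalerDr addrACA -scalerDl addNr scale0r addr0.
by rewrite -mulr2n -[X in _ *: X]scaler_nat scalerA mulVf// scale1r.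
Qed.

(** Before the splitting of the frequencies, nothing has changed on the span of
    [h]. *)
Lemma diag_half_sum (lam : I -> R) t u : in_span h u ->
  diag_group half_sum_orthonormal (fun p => lam p.1) t u = diag_group oh lam t u.
Proof.
move=> hu; rewrite /= /diag_op; congr (_ + _).
rewrite -(pair_bigA _ (fun a s => ((phase (fun p => lam p.1) t (a, s) - 1)
   * inner u (half_sum (a, s))) *: half_sum (a, s)))/=.
apply: eq_bigr => a _; rewrite big_bool/= !inner_half_sum//.
rewrite [X in _ = _ *: X]half_sumD.
move: (half_sum (a, true)) (half_sum (a, false)) => p q.
by rewrite scalerDr !scalerA; congr (_ *: _ + _ *: _); rewrite /phase/=; ring.
Qed.

Lemma diag_half_sum_orthogonal (lam : I -> R) (c : R) u v : 0 < c ->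
  in_span h u -> in_span h v ->
  inner (diag_group half_sum_orthonormal
    (fun p => lam p.1 + (-1) ^+ p.2 * c) (pi / 2 / c) u) v = 0.
Proof.
move=> c0 hu hv; apply: in_span_orthogonal hv _ => a.
have innerE p q w : inner w (r *: p + r *: q) = r * inner w p + r * inner w q.
  by rewrite innerDr !innerZr rJ.
rewrite half_sumD innerE !inner_diag_group.
have : c * (pi / 2 / c) = pi / 2 by rewrite mulrC divfK// gt_eqF.
move: (pi / 2 / c) => t ct.
have cisN : cis (- (pi / 2)) = - cis (pi / 2) :> R[i].
  rewrite /cis cosN sinN cos_pihalf; apply/eqP.
  by rewrite eq_complex/= oppr0 !eqxx.
rewrite !inner_half_sum//= expr0 expr1 !mulrDl !cisD mul1r mulN1r mulNr ct cisN.
by ring.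
Qed.

End Rotation.

(** * Dense families of groups and category *)

Section Density.
Context {R : realType} {H : hilbertType R} (x : dense_sequence H).
Implicit Types (U V : unitary_group H).

(** Both density results perturb a diagonal approximation further. The tolerance
    [d] is what the neighbourhood of [U] leaves for this; it concerns finitely
    many vectors, which the eigenvectors span, so that a perturbation can be
    controlled through the frequencies alone. *)
Lemma diag_approximation U (e : R) k : 0 < e ->
  exists n (h : 'I_n -> H) (oh : orthonormal_family h) (lam : 'I_n -> R) K,
  exists2 d : R, 0 < d & [/\ (k <= K)%N, forall j, (j < K)%N -> in_span h (x j) &
    forall V, (forall j t, (j < K)%N -> `|t| <= K%:R ->
      hnorm (diag_group oh lam t (x j) - V t (x j)) <= d) -> udist x U V < e].
Proof.
move=> e0; have [k' [d d0 dU]] := udist_small x e0.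
pose K := (maxn k k').+1; have d20 : 0 < d / 2 by rewrite divr_gt0.
have [|n [h [oh [lam hU]]]] := @spectral_approximation _ _ U
    [seq x j | j <- iota 0 K] K%:R _ _ d20; first by rewrite ltr0n.
have {}hU j : (j < K)%N -> in_span h (x j) /\ forall t, `|t| <= K%:R ->
    hnorm (U t (x j) - diag_group oh lam t (x j)) <= d / 2.
  by move=> jK; apply: hU; rewrite map_f// mem_iota.
have kK : (k' <= K)%N by rewrite /K (leq_trans (leq_maxr k k')).
exists n, h, oh, lam, K, (d / 2) => //; split.
- by rewrite /K (leq_trans (leq_maxl k k')).
- by move=> j /hU[].
move=> V UV; apply: dU => j t jk tk.
have jK := leq_trans jk kK.
have tK : `|t| <= K%:R by rewrite (le_trans tk)// ler_nat.
rewrite (le_trans (hdist_triangle (diag_group oh lam t (x j)) _ _))//.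
by rewrite [leRHS]splitr lerD//; [have [_] := hU j jK; apply|exact: UV].
Qed.

(** Round the frequencies of a diagonal approximation to multiples of a small
    [c]. *)
Lemma recurrent_dense U (e : R) : 0 < e -> exists2 V, udist x U V < e &
  forall T u, exists2 t, T <= t & V t u = u.
Proof.
move=> e0; have [n [h [oh [lam [K [d d0 [_ _ UV]]]]]]] := diag_approximation U 0 e0.
have [c c0 cd] := diag_perturbation oh x K d0.
exists (diag_group oh (fun i => c * (Num.floor (lam i / c))%:~R)).
  by apply: UV => j t jK tK; apply: cd => // i; exact: floor_round.
by move=> T u; exact: diag_group_recurrent.
Qed.

(** Apply the slow rotation into an orthogonal copy to a diagonal approximation:
    it hardly moves the finitely many vectors that matter on the relevant
    interval of times, and at a much later time it makes their images orthogonal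
    to all of them. *)
Lemma orthogonalizing_dense U (e : R) k : infinite_dimensional H -> 0 < e ->
  exists2 V, udist x U V < e &
  exists t, forall i j, (i < k)%N -> (j < k)%N -> inner (V t (x i)) (x j) = 0.
Proof.
move=> hH e0.
have [n [h [oh [lam [K [d d0 [kK hx UV]]]]]]] := diag_approximation U k e0.
have [h' [oh' hh']] := exists_orthogonal_copy h hH.
have [c c0 cd] := diag_perturbation (half_sum_orthonormal oh oh' hh') x K d0.
exists (diag_group (half_sum_orthonormal oh oh' hh')
    (fun p => lam p.1 + (-1) ^+ p.2 * c)).
  apply: UV => j t jK tK; rewrite -(diag_half_sum oh oh' hh' lam t (hx j jK)).
  apply: cd => // -[a s] /=.
  by rewrite opprD addNKr normrN normrM normrX normrN1 expr1n mul1r gtr0_norm.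
exists (pi / 2 / c) => i j ik jk.
by apply: diag_half_sum_orthogonal => //; apply: hx; exact: leq_trans kK.
Qed.

Lemma eval_near (V : ugroup_space x) t u v (e : R) : 0 < e ->
  \forall W \near V,
    cmod (inner ((W : ugroup_space x) t u) v - inner (V t u) v) < e.
Proof.
move=> e0; have v0 : 0 < hnorm v + 1 by rewrite ltr_wpDl// hnorm_ge0.
have [d d0 dV] := ugap_near x (Num.trunc `|t|).+1 u (divr_gt0 e0 v0).
apply/ugroup_nbhsP; exists d => // W /dV VW.
have tn : t \in `[- (Num.trunc `|t|).+1%:R, (Num.trunc `|t|).+1%:R].
  by rewrite in_itv/= -ler_norml ltW// truncnS_gt.
have {}VW : hnorm (W t u - V t u) <= e / (hnorm v + 1).
  by rewrite hdistC (le_trans (ugap_ub V W u tn)).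
rewrite -innerBl (le_lt_trans (cauchy_schwarz _ _))//.
rewrite (le_lt_trans (ler_wpM2r (hnorm_ge0 _) VW))// mulrAC.
by rewrite ltr_pdivrMr// ltr_pM2l// ltrDl.
Qed.

(** A nonempty open set contains a point outside [B], and around that point the
    set [B], hence also [A], is avoided. *)
Lemma nowhere_dense_sub (A B : set (ugroup_space x)) : A `<=` B ->
  (forall V : ugroup_space x, ~ B V -> nbhs V (~` B)) ->
  (forall (U : ugroup_space x) (e : R), 0 < e ->
    exists2 V, udist x U V < e & ~ B V) ->
  nowhere_dense A.
Proof.
move=> AB Bopen Bdense; apply/seteqP; split => // U /=.
move=> /ugroup_nbhsP[e e0 eU]; have [V UV VB] := Bdense U e e0.
by have [W [/AB]] := eU V UV _ (Bopen V VB).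
Qed.

(** If [U] is weakly stable, then [|<U t x0, x0>| <= |x0|^2 / 2] for all [t]
    after some integer time [n]. For fixed [n] this is a closed condition, which
    no recurrent group satisfies, as [V t x0 = x0] at arbitrarily late times. *)
Lemma weakly_stable_first_category :
  first_category [set U : ugroup_space x | weakly_stable U].
Proof.
pose c := hnorm (x 0%N) ^+ 2 / 2.
have c0 : 0 < c by rewrite divr_gt0// exprn_gt0// hdseq_gt0.
pose B n := [set U : ugroup_space x |
  forall t, n%:R <= t -> cmod (inner (U t (x 0%N)) (x 0%N)) <= c].
exists (fun n => [set U | weakly_stable U] `&` B n) => [n|]; last first.
  apply/seteqP; split => [U wU|U [n _ []//]].
  have : 0 < c%:C by rewrite ltcR.
  move/cvgrPdist_lt: (wU (x 0%N) (x 0%N)) => /[apply] -[M [_ MU]].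
  exists (Num.trunc `|M|).+1 => //; split => // t Mt.
  have := MU t; rewrite sub0r normrN.
  have -> : M < t.
    by rewrite (lt_le_trans _ Mt)// (le_lt_trans (ler_norm _))// truncnS_gt.
  by move=> /(_ isT); rewrite (cmodE (inner _ _)) ltcR => /ltW.
apply: (@nowhere_dense_sub _ (B n)) => [U []//|V|U e e0].
  move=> /existsNP[t /not_implyP[nt /negP]]; rewrite -ltNge => Vt.
  have := eval_near V t (x 0%N) (x 0%N) (etrans (subr_gt0 _ _) Vt).
  apply: filterS => W VW /(_ t nt) Wc.
  have := cmodD (inner (W t (x 0%N)) (x 0%N))
    (inner (V t (x 0%N)) (x 0%N) - inner (W t (x 0%N)) (x 0%N)).
  by rewrite addrC subrK -[X in _ + cmod X]opprB cmodN; lra.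
have [V UV Vt] := recurrent_dense U e0; exists V => //.
have [t nt Vtx] := Vt n%:R (x 0%N); move=> /(_ t nt); rewrite Vtx.
rewrite inner_hnorm cmod_real ?sqr_ge0//; move: c0; rewrite /c.
by move: (hnorm _ ^+ 2) => z; lra.
Qed.

(** A countable family of open conditions on [U], each about a single time and
    finitely many vectors of the dense sequence, which together force the mean
    of [|<U t u, v>|] over long intervals to vanish for all [u] and [v]. *)
Definition orthogonalizing U : Prop := forall n, exists t, forall i j,
  (i < n)%N -> (j < n)%N -> cmod (inner (U t (x i)) (x j)) < n.+1%:R^-1.

Lemma orthogonalizing_residual (P : set (ugroup_space x)) :
  infinite_dimensional H ->
  (forall U : ugroup_space x, orthogonalizing U -> P U) -> residual P.
Proof.
move=> hH GP; pose B n := [set U : ugroup_space x | forall t,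
  exists i j, [/\ (i < n)%N, (j < n)%N &
    n.+1%:R^-1 <= cmod (inner (U t (x i)) (x j))]].
exists (fun n => ~` P `&` B n) => [n|]; last first.
  apply/seteqP; split => [U PU|U [n _ []//]].
  have /existsNP[n nU] : ~ orthogonalizing U by move=> /GP.
  exists n => //; split => // t; apply: contrapT => tU; apply: nU.
  exists t => i j ik jk.
  by rewrite ltNge; apply/negP => ?; apply: tU; exists i, j.
apply: (@nowhere_dense_sub _ (B n)) => [U []//|V|U e e0]; last first.
  have [V UV [t Vt]] := orthogonalizing_dense U n hH e0; exists V => //.
  move=> /(_ t)[i [j [ik jk]]]; rewrite Vt// cmod0.
  by rewrite leNgt invr_gt0 ltr0Sn.
move=> /existsNP[t tV].
have Vc i j : (i < n)%N -> (j < n)%N ->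
    cmod (inner (V t (x i)) (x j)) < n.+1%:R^-1.
  by move=> ik jk; rewrite ltNge; apply/negP => ?; apply: tV; exists i, j.
pose G (p : 'I_n * 'I_n) := [set W : ugroup_space x |
  cmod (inner (W t (x p.1)) (x p.2)) < n.+1%:R^-1].
have : nbhs V [set W | forall p, G p W].
  apply: (@filter_forall _ _ G _ (nbhs_filter V)) => -[i j].
  have := eval_near V t (x i) (x j)
    (etrans (subr_gt0 _ _) (Vc _ _ (ltn_ord i) (ltn_ord j))).
  apply: filterS => W VW; rewrite /G/=.
  rewrite -[inner (W _ _) _](subrK (inner (V t (x i)) (x j))).
  by rewrite (le_lt_trans (cmodD _ _))// -ltrBrDr.
apply: filterS => W Wt /(_ t)[i [j [ik jk]]].
by rewrite leNgt (Wt (Ordinal ik, Ordinal jk)).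
Qed.

End Density.

(** * Almost orthogonal points on an orbit *)

Section AlmostOrthogonal.
Context {R : realType} {H : hilbertType R}.
Implicit Types (u v w y : H) (U : unitary_group H).

Lemma inner_ugroup_approx U t u v u' v' :
  cmod (inner (U t u) v) <= cmod (inner (U t u') v') +
    (hnorm (u - u') * hnorm v + hnorm u' * hnorm (v - v')).
Proof.
have -> : inner (U t u) v = inner (U t u') v' +
    (inner (U t (u - u')) v + inner (U t u') (v - v')).
  by rewrite ugroupB innerBl innerBr; ring.
rewrite (le_trans (cmodD _ _))// lerD2l (le_trans (cmodD _ _))//.
by rewrite lerD// (le_trans (cauchy_schwarz _ _))// hnorm_ugroup.
Qed.

(** By density, the condition passes from the vectors [x i] to arbitrary finite
    sets of vectors. *)
Lemma orthogonalizing_seq (x : dense_sequence H) U (s : seq H) (e : R) :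
  orthogonalizing x U -> 0 < e ->
  exists t, forall u v, u \in s -> v \in s -> cmod (inner (U t u) v) < e.
Proof.
move=> oU e0.
have [C C0 sC] : exists2 C, 0 < C & forall u, u \in s -> hnorm u <= C.
  elim: s => [|w s [C C0 sC]]; first by exists 1.
  exists (C + hnorm w); first by rewrite ltr_wpDr// hnorm_ge0.
  move=> u; rewrite inE => /predU1P[->|/sC uC]; first by rewrite lerDr ltW.
  by rewrite (le_trans uC)// lerDl hnorm_ge0.
pose d := Num.min 1 (e / (4 * (C + 1))).
have C1 : 0 < 4 * (C + 1) by rewrite mulr_gt0// addr_gt0.
have d0 : 0 < d by rewrite lt_min ltr01 divr_gt0.
have d1 : d <= 1 by rewrite ge_min lexx.
(* The error terms add up to at most d C + (C + 1) d, that is, e / 2. *)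
have dC : d * (4 * (C + 1)) <= e by rewrite -ler_pdivlMr// ge_min lexx orbT.
have [n sn] : exists n, forall u, u \in s ->
    exists2 i, (i < n)%N & hnorm (u - x i) <= d.
  elim: s {sC} => [|w s [n sn]]; first by exists 0%N.
  have [i wi] := hdseq_near x w d0.
  exists (maxn n i.+1) => u; rewrite inE => /predU1P[->|/sn[j jn uj]].
    by exists i; rewrite ?leq_max ?ltnSn ?orbT// ltW.
  by exists j => //; rewrite leq_max jn.
pose n' := maxn n (Num.trunc (2 / e)).+1.
have [t tn] := oU n'; exists t => u v us vs.
have [i i_n ui] := sn u us; have [j jn vj] := sn v vs.
have nn' m : (m < n)%N -> (m < n')%N by move=> mn; rewrite leq_max mn.
have n'e : n'.+1%:R^-1 <= e / 2.
  rewrite -[e / 2]invrK lef_pV2 ?posrE ?invr_gt0 ?divr_gt0// invf_div.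
  by rewrite (le_trans (ltW (truncnS_gt _)))// ler_nat leqW// leq_maxr.
rewrite (le_lt_trans (inner_ugroup_approx U t u v (x i) (x j)))//.
have xi : hnorm (x i) <= C + d.
  have := hdist_triangle u (x i) 0; rewrite !subr0 hdistC => /le_trans; apply.
  by rewrite addrC lerD// sC.
have := ler_pM (hnorm_ge0 _) (hnorm_ge0 _) ui (sC v vs).
have := ler_pM (hnorm_ge0 _) (hnorm_ge0 _) xi vj.
have := tn i j (nn' _ i_n) (nn' _ jn).
have : (C + d) * d <= (C + 1) * d by rewrite ler_wpM2r ?(ltW d0)// lerD2l.
move: n'e dC d0; move: (_^-1) (cmod _) (_ * hnorm v) (hnorm (x i) * _).
by move=> p q a b; nra.
Qed.

(** Choose the times one after the other: [t] must make [U t u] almost orthogonal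
    to the points [U (s i) u] already chosen, which together with [u] are a
    finite set of vectors. *)
Lemma almost_orthogonal_times (x : dense_sequence H) U u (d : R) m :
  orthogonalizing x U -> 0 < d -> exists s : nat -> R, forall i j,
  (i < m)%N -> (j < m)%N -> i != j -> cmod (inner (U (s i) u) (U (s j) u)) <= d.
Proof.
move=> oU d0; elim: m => [|m [s sd]]; first by exists (fun=> 0).
have [t td] := orthogonalizing_seq (u :: [seq U (s i) u | i <- iota 0 m]) oU d0.
have tj j : (j < m)%N -> cmod (inner (U t u) (U (s j) u)) <= d.
  move=> jm; apply/ltW/td; first exact: mem_head.
  by apply: mem_behead; apply: map_f; rewrite mem_iota.
exists (fun i => if i == m then t else s i) => i j.
rewrite !ltnS leq_eqVlt (leq_eqVlt j).
case: (eqVneq i m) => [->|im]; case: (eqVneq j m) => [->|jm] //=.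
- by move=> _ jm' _; exact: tj.
- by move=> im' _ _; rewrite inner_conj cmodJ; exact: tj.
exact: sd.
Qed.

(** Bessel's inequality, with an error for the failure of orthogonality. For
    [c i = <y, f i>] and [z] the sum of the [c i *: f i], the left-hand side [Q]
    is [<y, z>], while [|z|^2] is at most [Q (r^2 + m d)], by
    [2 |c i| |c j| <= |c i|^2 + |c j|^2] in the cross terms; Cauchy-Schwarz then
    gives [Q^2 <= |y|^2 |z|^2]. *)
Lemma almost_orthogonal_bessel m (f : 'I_m -> H) (r d : R) y :
  (forall i, hnorm (f i) = r) -> 0 <= d ->
  (forall i j, i != j -> cmod (inner (f i) (f j)) <= d) ->
  \sum_i cmod (inner y (f i)) ^+ 2 <= hnorm y ^+ 2 * (r ^+ 2 + m%:R * d).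
Proof.
move=> fr d0 fd; pose A := r ^+ 2.
pose c i := inner y (f i); pose a i := cmod (c i).
pose Q := \sum_i a i ^+ 2; rewrite -/Q.
have a0 i : 0 <= a i by exact: cmod_ge0.
have Q0 : 0 <= Q by apply: sumr_ge0 => i _; rewrite exprn_ge0.
pose z := \sum_i c i *: f i.
have yz : Q%:C = inner y z.
  rewrite inner_sumr realC_sum; apply: eq_bigr => i _.
  by rewrite innerZr cmod_sqr mulrC.
have ij i j : cmod (inner (f i) (f j)) <= (i == j)%:R * A + d.
  have [<-|ij] := eqVneq i j; last by rewrite mul0r add0r fd.
  by rewrite mul1r inner_hnorm cmod_real ?sqr_ge0// fr lerDl.
have zQ : hnorm z ^+ 2 <= Q * (A + m%:R * d).
  rewrite -[hnorm z ^+ 2]cmod_real ?sqr_ge0// -inner_hnorm {1}/z inner_suml.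
  rewrite (le_trans (cmod_sum _))//.
  apply: (@le_trans _ _ (\sum_i \sum_j a i * a j * ((i == j)%:R * A + d))).
    apply: ler_sum => i _; rewrite innerZl cmodM inner_sumr -/(a i).
    rewrite [leRHS](_ : _ = a i * \sum_j a j * ((i == j)%:R * A + d));
      last by rewrite mulr_sumr; apply: eq_bigr => j _; rewrite mulrA.
    rewrite ler_wpM2l// (le_trans (cmod_sum _))//.
    by apply: ler_sum => j _; rewrite innerZr cmodM cmodJ ler_wpM2l ?ij ?cmod_ge0.
  have sumE : \sum_i \sum_j (a i ^+ 2 + a j ^+ 2) / 2 * d = Q * (m%:R * d).
    rewrite (eq_bigr (fun i => (m%:R * a i ^+ 2 + Q) / 2 * d)).
      rewrite -!mulr_suml big_split/= -mulr_sumr -/Q sumr_const card_ord.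
      by rewrite -[Q *+ m]mulr_natl; field.
    move=> i _; rewrite -!mulr_suml big_split/= -/Q sumr_const card_ord.
    by rewrite -[_ *+ m]mulr_natl.
  rewrite mulrDr -sumE mulr_suml -big_split/=; apply: ler_sum => i _.
  rewrite (eq_bigr (fun j => a i * a j * A * (i == j)%:R + a i * a j * d)).
    rewrite big_split/= lerD//.
      rewrite (bigD1 i)//= eqxx mulr1 big1 ?addr0// => j ji.
      by rewrite eq_sym (negbTE ji) mulr0.
    apply: ler_sum => j _; rewrite ler_wpM2r//.
    by have := sqr_ge0 (a i - a j); rewrite sqrrB; lra.
  by move=> j _; ring.
have QzQ : Q <= hnorm y * hnorm z.
  by rewrite -(cmod_real Q0) yz cauchy_schwarz.
have [->|Qn0] := eqVneq Q 0.
  by rewrite mulr_ge0 ?addr_ge0 ?sqr_ge0// mulr_ge0.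
have Qp : 0 < Q by rewrite lt_neqAle eq_sym Qn0.
rewrite -(ler_pM2l Qp) mulrCA -expr2.
rewrite (le_trans _ (ler_wpM2l (sqr_ge0 _) zQ))//.
by rewrite -exprMn ler_pXn2r ?nnegrE ?mulr_ge0 ?hnorm_ge0.
Qed.

End AlmostOrthogonal.

(** * Sets of times of density zero *)

Section Translation.
Context {R : realType}.
Local Notation mu := (@lebesgue_measure R).

Lemma lebesgue_measure_shift (s : R) (A : set R) : measurable A ->
  mu ((fun t : R => t + s) @^-1` A) = mu A.
Proof.
move=> mA; pose f (t : measurableTypeR R) : measurableTypeR R := t + s.
have mf : measurable_fun setT f by exact: measurable_funD.
apply/esym.
apply: (@lebesgue_measure_unique R (pushforward mu f)) mA => _ [[a b]] _ <-.
rewrite /pushforward/=.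
rewrite [X in _ = mu X](_ : _ = `]a - s, b - s]%classic); last first.
  by apply/seteqP; split => t /=; rewrite !in_itv/= ltrBlDr lerBrDr.
rewrite !lebesgue_measure_itv/= !lte_fin ltrD2r; case: ifPn => // _.
by rewrite -!EFinB; congr EFin; ring.
Qed.

Lemma measurable_shift (s : R) (A : set R) : measurable A ->
  measurable ((fun t : R => t + s) @^-1` A).
Proof.
move=> mA; rewrite -[X in measurable X]setTI.
pose f (t : measurableTypeR R) : measurableTypeR R := t + s.
have mf : measurable_fun setT f by exact: measurable_funD.
exact: mf.
Qed.

Lemma le_mu (A B : set R) : measurable A -> measurable B -> A `<=` B ->
  (mu A <= mu B)%E.
Proof. by move=> mA mB AB; apply: le_measure; rewrite ?inE. Qed.

Lemma mu_setU_le (A B : set R) : measurable A -> measurable B ->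
  (mu (A `|` B) <= mu A + mu B)%E.
Proof.
move=> mA mB; have mD : measurable (B `\` A) by exact: measurableD.
have -> : A `|` B = A `|` (B `\` A) by rewrite setDE setUIr setUCr setIT.
rewrite measureU//; last by rewrite setDE setICA setICr setI0.
by rewrite leeD2l// le_mu// => t [].
Qed.

Lemma mu_itv (a b : R) : a <= b -> mu `[a, b] = (b - a)%:E.
Proof.
move=> ab; rewrite lebesgue_measure_itv/= lte_fin.
by case: ltgtP ab => // -> _; rewrite subrr.
Qed.

(** Cutting to [[0, T]] before or after a translation by [s] differs only within
    distance [|s|] of the two endpoints. *)
Lemma mu_shift_itv (B : set R) (s T : R) : measurable B ->
  (mu (B `&` `[0%R, T]) <=
   mu ((fun t => t - s)%R @^-1` B `&` `[0%R, T]) + (2 * `|s|)%:E)%E.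
Proof.
move=> mB.
have -> : (fun t => t - s) @^-1` B `&` `[0, T] =
    (fun t => t - s) @^-1` (B `&` `[- s, T - s]).
  have E t : (- s <= t - s) = (0 <= t) by rewrite -{1}[- s]add0r lerD2r.
  by apply/seteqP; split => t [Bt /=]; rewrite !in_itv/= ?E ?lerD2r => tT;
    split => //=; rewrite in_itv/= ?E ?lerD2r.
rewrite lebesgue_measure_shift; last exact: measurableI.
pose E := `[0, `|s|] `|` `[T - `|s|, T] : set R.
have mE : measurable E by exact: measurableU.
apply: (@le_trans _ _ (mu ((B `&` `[- s, T - s]) `|` E))).
  apply: le_mu; first exact: measurableI.
    by apply: measurableU => //; exact: measurableI.
  move=> t [Bt /=]; rewrite in_itv/= => /andP[t0 tT].
  have [ts|st] := ltP t (- s).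
    right; left; rewrite /= in_itv/= t0 (le_trans (ltW ts))//.
    by rewrite -normrN ler_norm.
  have [ts|st'] := leP t (T - s).
    by left; split => //; rewrite /= in_itv/= st.
  right; right; rewrite /= in_itv/= tT andbT (le_trans _ (ltW st'))//.
  by rewrite lerD2l lerN2 ler_norm.
apply: (le_trans (mu_setU_le _ mE)); first exact: measurableI.
rewrite leeD2l// (le_trans (mu_setU_le _ _))//.
have Ts : T - `|s| <= T by rewrite gerBl.
by rewrite !mu_itv// -EFinD lee_fin; lra.
Qed.

(** Stated in the extended reals and without division, so that monotonicity and
    subadditivity of the measure apply directly. *)
Definition null_density (B : set R) := forall e, 0 < e ->
  \forall T \near +oo, (mu (B `&` `[0%R, T]) <= (e * T)%:E)%E.

(** Exchange the finite sum with the integral of the indicators. *)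
Lemma sum_mu_le m (B : 'I_m -> set R) (K T : R) : 0 <= T -> 0 <= K ->
  (forall i, measurable (B i)) ->
  (forall t, \sum_i \1_(B i) t <= K) ->
  (\sum_i mu (B i `&` `[0%R, T]) <= (K * T)%:E)%E.
Proof.
move=> T0 K0 mB BK; pose D : set R := `[0, T]%classic.
have mD : measurable D by exact: measurable_itv.
have -> : (\sum_i mu (B i `&` D) =
    \int[mu]_(t in D) (\sum_i (\1_(B i) t)%:E))%E.
  rewrite ge0_integral_sum//.
  - by apply: eq_bigr => i _; rewrite integral_indic; [|exact: mD|exact: mB].
  - by move=> i; apply/measurable_EFinP/measurable_indic; exact: mB.
have -> : (K * T)%:E = (\int[mu]_(t in D) (cst K%:E t))%E.
  rewrite integral_cst; last exact: mD.
  have muD : mu D = T%:E by rewrite /D mu_itv// subr0.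
  by rewrite EFinM -muD.
apply: ge0_le_integral => //.
- by move=> t _; apply: sume_ge0.
- apply: emeasurable_sum => i.
  by apply/measurable_EFinP/measurable_indic; exact: mB.
by move=> t _; rewrite sumEFin lee_fin.
Qed.

(** If [B] has arbitrarily many translates such that no point lies in more than
    [K] of them, then [m] times the measure of [B] in [[0, T]] is at most [K T]
    up to a constant, so that the upper density of [B] is at most [K / m] for
    all [m]. *)
Lemma shift_packing_null_density (B : set R) (K : R) : measurable B -> 0 <= K ->
  (forall m, exists s : nat -> R, forall t, \sum_(i < m) \1_B (t - s i) <= K) ->
  null_density B.
Proof.
move=> mB K0 BK e e0.
pose m := (Num.trunc (2 * K / e)).+1.
have m0 : 0 < m%:R :> R by rewrite ltr0n.
have Km : K <= e / 2 * m%:R.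
  rewrite mulrC -ler_pdivrMr ?divr_gt0// invf_div mulrA (mulrC K).
  by rewrite ltW// truncnS_gt.
have [s sK] := BK m; pose C := \sum_(i < m) (2 * `|s i|).
have C0 : 0 <= C by apply: sumr_ge0.
exists (2 * C / e); split => [|T TC]; first exact: num_real.
have T0 : 0 <= T by rewrite (le_trans _ (ltW TC))// divr_ge0 ?mulr_ge0// ltW.
have {}TC : C <= e / 2 * T * m%:R.
  move: TC; rewrite ltr_pdivrMr// => TC.
  have : C <= e / 2 * T by lra.
  move=> /le_trans; apply; rewrite ler_peMr ?ler1n//.
  by rewrite mulr_ge0 ?divr_ge0// ltW.
have mBT : measurable (B `&` `[0, T]) by exact: measurableI.
have /fineK b_fin : mu (B `&` `[0, T]) \is a fin_num.
  rewrite ge0_fin_numE// (@le_lt_trans _ _ (mu `[0, T]))//.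
    by apply: le_mu => // t [].
  by rewrite mu_itv// ltry.
set b := fine _ in b_fin.
have := @sum_mu_le m (fun i => (fun t => t - s i) @^-1` B) K T T0 K0
  (fun i => measurable_shift (- s i) mB) sK.
move=> /(leeD2r C%:E); rewrite -EFinD /C -sumEFin -big_split/= => h.
have : (\sum_(i < m) mu (B `&` `[0%R, T]) <= (K * T + C)%:E)%E.
  by apply: le_trans h; apply: lee_sum => i _; exact: mu_shift_itv.
rewrite -b_fin sumEFin !lee_fin sumr_const card_ord -[b *+ m]mulr_natl => bm.
rewrite -(ler_pM2l m0) (le_trans bm)//.
have := ler_wpM2r T0 Km; lra.
Qed.

End Translation.

(** * A common set of good times *)

Section DensityOne.
Context {R : realType}.
Implicit Types B : nat -> set R.
Local Notation mu := (@lebesgue_measure R).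

Lemma null_density_setU (A B : set R) : measurable A -> measurable B ->
  null_density A -> null_density B -> null_density (A `|` B).
Proof.
move=> mA mB nA nB e e0; have e20 : 0 < e / 2 by rewrite divr_gt0.
apply: filterS2 (nA _ e20) (nB _ e20) => T AT BT.
rewrite setIUl (le_trans (mu_setU_le _ _))//; [exact: measurableI|exact: measurableI|].
by rewrite (le_trans (leeD AT BT))// -EFinD lee_fin -mulrDl -splitr.
Qed.

Lemma null_density_set0 : null_density (set0 : set R).
Proof.
move=> e e0; near=> T; rewrite set0I measure0 lee_fin.
by rewrite mulr_ge0 ?(ltW e0)//; near: T; exact: nbhs_pinfty_ge.
Unshelve. all: end_near. Qed.

(** Exclude [B n] only from the time [T n] on, where [T n] is so late that [B n]
    fills at most the proportion [1 / (n + 1)] of [[0, t]] for all [t >= T n].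
    As the sets increase, what has been excluded from [[0, t]] is contained in
    [B N], for the largest [N] with [T N <= t]; it exists because
    [n <= T n]. *)
Lemma density_one_diagonal B : (forall n, measurable (B n)) ->
  (forall n, null_density (B n)) -> (forall n m, (n <= m)%N -> B n `<=` B m) ->
  exists M : set R, [/\ measurable M, M `<=` `[0, +oo[, density_one M &
    forall n, \forall t \near +oo, M t -> ~ B n t].
Proof.
move=> mB nB B_mono.
have /choice[T TP] n : exists T : R, n%:R <= T /\ forall t, T <= t ->
    (mu (B n `&` `[0%R, t]) <= (n.+1%:R^-1 * t)%:E)%E.
  have [|T [_ TB]] := nB n n.+1%:R^-1; first by rewrite invr_gt0.
  exists (Num.max n%:R (T + 1)); rewrite le_max lexx; split => // t.
  by rewrite ge_max => /andP[_ Tt]; apply: TB; rewrite (lt_le_trans _ Tt)// ltrDl.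
pose E n := [set t | T n <= t] `&` B n.
have mE n : measurable (E n).
  apply: measurableI => //.
  rewrite (_ : [set t | _] = `[T n, +oo[%classic)//.
  by apply/seteqP; split => t /=; rewrite in_itv/= andbT.
pose M := `[0, +oo[%classic `\` \bigcup_n E n.
have mU : measurable (\bigcup_n E n) by exact: bigcupT_measurable.
have mM : measurable M by exact: measurableD.
exists M; split => //.
- by move=> t [].
- have Et k t : T k <= t ->
      (mu (\bigcup_n E n `&` `[0%R, t]) <= (k.+1%:R^-1 * t)%:E)%E.
    move=> kt; have t0 : 0 <= t by rewrite (le_trans _ kt)// (le_trans _ (TP k).1).
    have exT : exists n, T n <= t by exists k.
    have ubT n : T n <= t -> (n <= Num.trunc t)%N.
      by move=> nt; rewrite truncn_ge_nat//; exact: le_trans (TP n).1 nt.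
    have [N Nt Nmax] := ex_maxnP exT ubT.
    have kN := Nmax k kt.
    apply: (@le_trans _ _ (mu (B N `&` `[0%R, t])%classic)).
      apply: le_mu; [exact: measurableI|exact: measurableI|].
      move=> r [[n _ [/= nr Bnr]] rt]; split => //; apply: B_mono Bnr; apply: Nmax.
      by move: rt; rewrite /= in_itv/= => /andP[_]; exact: le_trans nr.
    rewrite (le_trans ((TP N).2 t Nt))// lee_fin ler_wpM2r//.
    by rewrite lef_pV2 ?posrE// ler_nat.
  apply/cvgrPdist_le => e e0.
  pose k := Num.trunc e^-1.
  near=> t.
  have t0 : 0 < t by near: t; exact: nbhs_pinfty_gt.
  have kt : T k <= t by near: t; apply: nbhs_pinfty_ge; exact: num_real.
  have mt : measurable (`[0, t]%classic : set R) by exact: measurable_itv.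
  have Mfin A : measurable A -> (mu (A `&` `[0%R, t]) \is a fin_num)%E.
    move=> mA; rewrite ge0_fin_numE// (@le_lt_trans _ _ (mu `[0%R, t]))//.
      apply: le_mu; [exact: measurableI|exact: mt|exact: subIsetr].
    by rewrite mu_itv ?ltry// ltW.
  have : mu `[0, t] = (mu (M `&` `[0%R, t]) + mu (\bigcup_n E n `&` `[0%R, t]))%E.
    rewrite -measureU; [|exact: measurableI|exact: measurableI|].
      congr (mu _); apply/seteqP; split => [r rt|r [[]|[]]//].
      have [rE|rE] := pselect ((\bigcup_n E n) r); [by right|left].
      by split => //; split => //; move: rt; rewrite /= !in_itv/= => /andP[->].
    by apply/seteqP; split => // r [[[_ nr] _] [/nr]].
  rewrite mu_itv ?(ltW t0)// subr0.
  move/fineK: (Mfin M mM) => <-; have := Et k t kt; move/fineK: (Mfin _ mU) => <-.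
  set b := fine _; set a := fine _; rewrite -EFinD lee_fin => bk [tab].
  have -> : 1 - a / t = b / t by rewrite tab; field; rewrite -tab gt_eqF.
  rewrite ger0_norm ?divr_ge0 ?(ltW t0) ?fine_ge0//.
  rewrite ler_pdivrMr// (le_trans bk)// ler_wpM2r ?(ltW t0)//.
  rewrite -[e]invrK lef_pV2 ?posrE ?invr_gt0//.
  by rewrite ltW// truncnS_gt.
move=> n; near=> t => -[_ tE] Bt; apply: tE; exists n => //; split => //=.
Unshelve. all: end_near. Qed.

End DensityOne.

(** * Almost weak stability *)

Section LevelSets.
Context {R : realType} {H : hilbertType R}.
Implicit Types (u v : H) (U : unitary_group H).

Definition level_set U u v (e : R) := [set t | e <= cmod (inner (U t u) v)].

Lemma measurable_level_set U u v e : measurable (level_set U u v e).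
Proof.
pose f t := cmod (inner (U t u) v).
have cf : continuous f.
  move=> t; apply/cvgrPdist_lt => d d0.
  have v0 : 0 < hnorm v + 1 by rewrite ltr_wpDl// hnorm_ge0.
  have /hcvgP/(_ _ (divr_gt0 d0 v0)) := @ugroup_continuous _ _ U u t.
  apply: filterS => r; rewrite ltr_pdivlMr// => Ur.
  rewrite (le_lt_trans _ Ur)//.
  apply: (@le_trans _ _ (hnorm (U t u - U r u) * hnorm v)); last first.
    by rewrite ler_wpM2l ?hnorm_ge0// lerDl.
  apply: le_trans (cauchy_schwarz _ _); rewrite innerBl /f.
  move: (inner _ _) (inner _ _) => a b; rewrite ler_norml.
  have := cmodD (a - b) b; have := cmodD (b - a) a.
  by rewrite !subrK -(cmodN (b - a)) opprB => ? ?; apply/andP; split; lra.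
rewrite (_ : level_set U u v e = f @^-1` `[e, +oo[); last first.
  by apply/seteqP; split => t /=; rewrite /level_set/= in_itv/= andbT.
rewrite -[X in measurable X]setTI; apply: continuous_measurable_fun => //.
Qed.

Lemma inner_ugroup_adjoint U s t u v :
  inner (U (t - s) u) v = inner (U t u) (U s v).
Proof.
transitivity (inner (U s (U (t - s) u)) (U s v)).
  exact/esym/ugroup_isometry.
by rewrite -ugroupD addrC subrK.
Qed.

(** The point [t] lies in the translate of the level set by [s i] exactly if
    [|<U t u, U (s i) v>| >= e]. For almost orthogonal points [U (s i) v] of the
    orbit of [v], Bessel's inequality bounds the number of such [i]
    independently of [t] and of the number of points. *)
Lemma level_set_null_density (x : dense_sequence H) U u v (e : R) :
  orthogonalizing x U -> 0 < e -> null_density (level_set U u v e).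
Proof.
move=> oU e0.
apply: (@shift_packing_null_density _ _
  (e ^- 2 * (hnorm u ^+ 2 * (hnorm v ^+ 2 + 1)))).
- exact: measurable_level_set.
- by rewrite mulr_ge0 ?invr_ge0 ?exprn_ge0 ?(ltW e0)// mulr_ge0 ?addr_ge0 ?sqr_ge0.
move=> m; have m0 : 0 < m.+1%:R^-1 :> R by rewrite invr_gt0.
have [s sm] := almost_orthogonal_times v m oU m0; exists s => t.
have e20 : 0 < e ^+ 2 by rewrite exprn_gt0.
rewrite mulrC ler_pdivlMr// mulr_suml.
apply: (@le_trans _ _ (\sum_(i < m) cmod (inner (U t u) (U (s i) v)) ^+ 2)).
  apply: ler_sum => i _; rewrite indicE /level_set.
  have [|_] := boolP (_ \in _); last by rewrite mul0r sqr_ge0.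
  rewrite inE/= mul1r inner_ugroup_adjoint => ei.
  by rewrite ler_pXn2r ?nnegrE ?cmod_ge0 ?(ltW e0).
apply: (le_trans (@almost_orthogonal_bessel _ _ m (fun i => U (s i) v)
  (hnorm v) m.+1%:R^-1 (U t u) _ _ _)).
- by move=> i; exact: hnorm_ugroup.
- exact: ltW.
- by move=> i j ij; apply: sm.
rewrite hnorm_ugroup ler_wpM2l ?sqr_ge0// lerD2l ler_pdivrMr// mul1r ler_nat.
exact: leqnSn.
Qed.

(** The set [B n] of bad times collects the finitely many pairs of vectors [x i],
    [x j] with indices below [n], at threshold [1 / (n + 1)]; one set [M] that
    eventually avoids every [B n] serves all pairs of vectors, by density. *)
Lemma orthogonalizing_almost_weakly_stable (x : dense_sequence H) U :
  orthogonalizing x U -> almost_weakly_stable U.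
Proof.
move=> oU.
pose s n := [seq (i, j) | i <- iota 0 n, j <- iota 0 n].
pose B n := \bigcup_(p in [set` s n]) level_set U (x p.1) (x p.2) n.+1%:R^-1.
have mnB n : measurable (B n) /\ null_density (B n).
  rewrite /B bigcup_seq; elim/big_ind : _ => [|A A' [mA nA] [mA' nA']|p _].
  - by split => //; exact: null_density_set0.
  - by split; [exact: measurableU|exact: null_density_setU].
  split; first exact: measurable_level_set.
  by apply: level_set_null_density oU _; rewrite invr_gt0.
have sP n i j : ((i, j) \in s n) = (i < n)%N && (j < n)%N.
  apply/allpairsP/andP => [[[a b] /= [+ + [-> ->]]]|[i_n jn]].
    by rewrite !mem_iota.
  by exists (i, j); rewrite !mem_iota.
have B_mono n m : (n <= m)%N -> B n `<=` B m.
  move=> nm t [[i j] /= ijn ijt]; exists (i, j).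
    by move: ijn; rewrite /= !sP => /andP[? ?]; rewrite !(leq_trans _ nm).
  rewrite /level_set/= (le_trans _ ijt)// lef_pV2 ?posrE// ler_nat//.
have [M [mM M0 dM MB]] := density_one_diagonal
  (fun n => (mnB n).1) (fun n => (mnB n).2) B_mono.
exists M; split => // u v; apply/cvgrPdist_lt => e e0.
have eE : e = (complex.Re e)%:C by rewrite RRe_real// gtr0_real.
move: e0; rewrite eE ltcR; move: (complex.Re e) => {eE} e' e0.
have v0 : 0 < hnorm v + 1 by rewrite ltr_wpDl// hnorm_ge0.
have e40 : 0 < e' / 4 by rewrite divr_gt0.
have [i ui] := hdseq_near x u (divr_gt0 e40 v0).
have x0 : 0 < hnorm (x i) + 1 by rewrite ltr_wpDl// hnorm_ge0.
have [j vj] := hdseq_near x v (divr_gt0 e40 x0).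
pose n := maxn (maxn i j).+1 (Num.trunc (2 / e')).+1.
have i_n : (i < n)%N by rewrite leq_max ltnS leq_maxl.
have jn : (j < n)%N by rewrite leq_max ltnS leq_maxr.
have ne : n.+1%:R^-1 <= e' / 2.
  rewrite -[e' / 2]invrK lef_pV2 ?posrE ?invr_gt0 ?divr_gt0// invf_div.
  by rewrite (le_trans (ltW (truncnS_gt _)))// ler_nat leqW// leq_maxr.
apply: filterS (MB n) => t tB Mt; rewrite sub0r normrN cmodE ltcR.
have tn : cmod (inner (U t (x i)) (x j)) < n.+1%:R^-1.
  rewrite ltNge; apply/negP => tn; apply: (tB Mt); exists (i, j) => //.
  by rewrite /= sP i_n jn.
rewrite (le_lt_trans (inner_ugroup_approx U t u v (x i) (x j)))//.
move: ui vj; rewrite !ltr_pdivlMr// => ui vj.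
move: tn ne (hnorm_ge0 (u - x i)) (hnorm_ge0 (v - x j)) ui vj.
move: (_^-1) (cmod _) (hnorm (u - _)) (hnorm (v - _)) (hnorm v) (hnorm (x i)).
by move=> p q a b c d; nra.
Qed.

End LevelSets.

(** * Weak stability is meagre, almost weak stability is residual *)

Theorem theorem2p5 (R : realType) (H : hilbertType R)
    (x : dense_sequence H) (hH : infinite_dimensional H) :
  first_category [set U : ugroup_space x | weakly_stable U] /\
  residual [set U : ugroup_space x | almost_weakly_stable U].
Proof.
split; first exact: weakly_stable_first_category.
apply: orthogonalizing_residual => // U.
exact: orthogonalizing_almost_weakly_stable.
Qed.
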